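(* Let $X,Y$ be Asplund spaces, $P$ a topological space, $C\subset Y$ a proper closed convex cone, and $F:X\times P\rightrightarrows Y$ a set-valued map with $0\in F(\overline{x},\overline{p})$. For $p\in P$ write $F_p(\cdot)=F(\cdot,p)$, let $H(x,p)=F(x,p)+C$ and $S(p)=\{x\in X\mid 0\in H(x,p)\}$. Suppose: (i) there is a neighborhood $U_1$ of $\overline{p}$ such that $\operatorname{Gr}F_p$ is closed for every $p\in U_1$; (ii) $F$ is inner semicontinuous at $((\overline{x},\overline{p}),0)$; (iii) there exist $r,c>0$ and a neighborhood $U_2$ of $\overline{p}$ such that for every $p\in U_2$, every $(x,y)\in\operatorname{Gr}F_p\cap[B(\overline{x},r)\times B(0,r)]$, every $y^*\in\mathbb{S}_{Y^*}\cap C^*$, every $z^*\in 2c\,\mathbb{B}_{Y^*}$ and every $x^*\in\widehat{D}^*F_p(x,y)(y^*+z^* )$, one has $c\|y^*+z^*\|\le\|x^*\|$. Then for every $a\in(0,c)$ there exist a neighborhood $U$ of $\overline{p}$ and $\tau>0$ such that for every $(x,p)\in B(\overline{x},\tau)\times U$, \[ d(x,S(p))\le a^{-1}d(0,F(x,p)). \] If moreover $P$ is a metric space, then for every $a\in(0,c)$ there exist $\tau_0>0,\gamma_0>0$ such that for every $(x,p)\in B(\overline{x},\tau_0)\times B(\overline{p},\gamma_0)$, \[ d((p,x),\operatorname{Gr}S)\le(1+a^{-1})\,d((x,p,0),\operatorname{Gr}F). \]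
   Context: $B(x,r)$ is the open ball, $\mathbb{B}_{Y^*}$ the open unit ball and $\mathbb{S}_{Y^*}$ the unit sphere of $Y^*$. $d(x,A)=\inf_{a\in A}\|x-a\|$, $d(x,\emptyset)=\infty$. $C^*=\{y^*\in Y^*\mid y^*(y)\ge0\ \forall y\in C\}$. A multifunction $F$ is inner semicontinuous at $(w,\overline{y})\in\operatorname{Gr}F$ if for every open $D\ni\overline{y}$ there is a neighborhood $U$ of $w$ with $F(u)\cap D\ne\emptyset$ for all $u\in U$. For a set $\Omega$ and $\overline{x}\in\Omega$, the Fréchet normal cone is $\widehat N(\Omega,\overline{x})=\{x^*\mid\limsup_{u\to\overline{x},u\in\Omega}\frac{x^*(u-\overline{x})}{\|u-\overline{x}\|}\le0\}$. The Fréchet coderivative of $G:X\rightrightarrows Y$ at $(x,y)\in\operatorname{Gr}G$ is $\widehat D^*G(x,y)(y^* )=\{x^*\mid(x^*,-y^* )\in\widehat N(\operatorname{Gr}G,(x,y))\}$. $\operatorname{Gr}S=\{(p,x)\mid x\in S(p)\}$; distances on products use the sum of the norms/metrics. *)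

(* Defs.v *)
From HB Require Import structures.
From mathcomp Require Import all_boot all_order all_algebra.
From mathcomp Require Import all_classical all_reals all_analysis.
Set Implicit Arguments. Unset Strict Implicit. Unset Printing Implicit Defensive.
Import Order.TTheory GRing.Theory Num.Theory.
Import numFieldNormedType.Exports.
Local Open Scope classical_set_scope.
Local Open Scope ring_scope.

Section Defs.
Variable R : realType.

Definition is_dual (V : normedModType R) (f : V -> R) : Prop :=
  (forall (a : R) (u v : V), f (a *: u + v) = a * f u + f v) /\ continuous f.

Definition dnorm (V : normedModType R) (f : V -> R) : R :=
  sup [set `|f x| | x in [set x : V | `|x| <= 1]].

(* distance to a set (extended real: d(x, emptyset) = +oo) *)
Definition dist_set (V : normedModType R) (x : V) (A : set V) : \bar R :=
  ereal_inf [set (`|x - a|)%:E | a in A].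

Definition convex_setV (V : normedModType R) (U : set V) : Prop :=
  forall x y t, U x -> U y -> 0 <= t <= 1 -> U (t *: x + (1 - t) *: y).

Definition convex_fun_on (V : normedModType R) (U : set V) (f : V -> R) : Prop :=
  forall x y t, U x -> U y -> 0 <= t <= 1 ->
    f (t *: x + (1 - t) *: y) <= t * f x + (1 - t) * f y.

(* Asplund space (Asplund's original definition): a Banach space on which every
   continuous convex function on an open convex set U is Frechet differentiable
   on a dense G_delta subset of U. *)
Definition asplund (V : completeNormedModType R) : Prop :=
  forall (U : set V) (f : V -> R), open U -> convex_setV U ->
    {within U, continuous f} -> convex_fun_on U f ->
    exists O : nat -> set V, (forall n, open (O n)) /\
      let D := U `&` [set x | forall n, O n x] in
      U `<=` closure D /\ (forall x, D x -> differentiable f x).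

Definition proper_closed_convex_cone (V : normedModType R) (C : set V) : Prop :=
  C 0 /\ (forall (t : R) c, 0 <= t -> C c -> C (t *: c)) /\
  (forall c d, C c -> C d -> C (c + d)) /\ closed C /\
  C <> [set 0] /\ C <> setT.

Definition in_dual_cone (V : normedModType R) (C : set V) (ys : V -> R) : Prop :=
  is_dual ys /\ forall y, C y -> 0 <= ys y.

(* Frechet coderivative: xs \in D^*G(x,y)(ys) iff (xs, -ys) is a Frechet normal
   to G at (x,y), product norm = sum of norms; the limsup <= 0 is unfolded. *)
Definition frechet_coderiv (X Y : normedModType R) (G : set (X * Y))
    (x : X) (y : Y) (ys : Y -> R) (xs : X -> R) : Prop :=
  is_dual xs /\
  forall eps : R, 0 < eps -> exists delta : R, 0 < delta /\
    forall (u : X) (v : Y), G (u, v) -> `|u - x| + `|v - y| < delta ->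
      xs (u - x) - ys (v - y) <= eps * (`|u - x| + `|v - y|).

Definition metric_of (P : topologicalType) (dP : P -> P -> R) : Prop :=
  (forall p q, 0 <= dP p q) /\ (forall p q, dP p q = 0 <-> p = q) /\
  (forall p q, dP p q = dP q p) /\
  (forall p q s, dP p s <= dP p q + dP q s) /\
  (forall p (U : set P), nbhs p U <->
     exists e : R, 0 < e /\ [set q | dP p q < e] `<=` U).

End Defs.

(* Main.v *)
Require Import Defs.
From HB Require Import structures.
From mathcomp Require Import all_boot all_order all_algebra.
From mathcomp Require Import all_classical all_reals all_analysis.
From mathcomp Require Import ring lra.
Import Order.TTheory GRing.Theory Num.Theory.
Import numFieldNormedType.Exports.
Local Open Scope classical_set_scope.
Local Open Scope ring_scope.

(** Let [phi] be the distance to [- C]. Ekeland's principle applied to [phi v] on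
    the graph of [F_p] yields either a point with [phi v = 0], i.e. an element of
    [S p], or a point [wb] of the graph that minimises a convex Lipschitz function
    [g], the sum of [phi] and a small multiple of a norm. In the latter case a
    fuzzy sum rule gives an exact Frechet normal to the graph at a nearby point,
    close to the negative of a subgradient of [g]; since subgradients of [phi] off
    [- C] are unit vectors of the dual cone, this contradicts (iii).

    The fuzzy sum rule in Asplund spaces is obtained without smooth renorming.
    - Say that a set of functionals is covered if, on a given countable set of
      directions, it is contained in countably many [eps]-balls. Covered sets form
      a sigma-ideal. If a dual ball were not covered, the essential supremum
      [p z = inf {c | {f | f z > c} is covered}] would be a continuous sublinear
      function, and at a point of Frechet differentiability of [p] the (not
      covered) slice [{f | f z > p z - t}] would be, up to a covered set, within
      [eps] of the derivative: a contradiction.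
    - On the closure of a countable set, a convex function [g] is therefore the
      supremum of countably many pieces, each linear up to an [eps]-Lipschitz
      term. Adding decreasing constants to the pieces makes the supremum locally a
      finite maximum, which is smoothed by log-sum-exp; Ekeland's principle then
      gives [eps]-normals, and iterating with [eps -> 0] an exact normal.
    - The set is a countable orbit under witness functions, chosen so that, by the
      Hahn-Banach theorem, a normal to its closure can be replaced by a normal to
      the whole graph. *)

(** * Hahn-Banach *)

Lemma inf_approx {R : realType} (S : set R) (b : R) :
  S !=set0 -> (forall s, S s -> b <= s) ->
  (forall s, S s -> inf S <= s) /\
  (forall e, 0 < e -> exists2 s, S s & s < inf S + e).
Proof.
move=> S0 lb; have hlb : has_lbound S by exists b => s /lb.
split=> [s Ss|e e0]; first exact: ge_inf.
by have [s Ss se] := inf_adherent e0 (conj S0 hlb); exists s.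
Qed.

Lemma le_of_approx {R : realType} (x y : R) :
  (forall e, 0 < e -> x <= y + e) -> x <= y.
Proof. by move=> h; apply/ler_addgt0Pr => e /h. Qed.

Section HahnBanach.
Context {R : realType} {V : lmodType R}.

Definition linear_form (f : V -> R) :=
  forall a u v, f (a *: u + v) = a * f u + f v.

(** Homogeneity is asked only as an inequality for positive factors, the form easily checked for
    infima; equality follows in [sublinearZ]. *)
Definition sublinear (p : V -> R) :=
  (forall x y, p (x + y) <= p x + p y) /\
  (forall t x, 0 < t -> p (t *: x) <= t * p x).

Lemma linear_form0 f : linear_form f -> f 0 = 0.
Proof. by move=> h; have := h 1 0 0; rewrite scaler0 addr0; lra. Qed.

Lemma linear_formZ f a u : linear_form f -> f (a *: u) = a * f u.
Proof. by move=> h; have := h a u 0; rewrite linear_form0// !addr0. Qed.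

Lemma linear_formD f u v : linear_form f -> f (u + v) = f u + f v.
Proof. by move=> h; have := h 1 u v; rewrite scale1r mul1r. Qed.

Lemma linear_formN f u : linear_form f -> f (- u) = - f u.
Proof. by move=> h; rewrite -scaleN1r linear_formZ// mulN1r. Qed.

Lemma linear_formB f u v : linear_form f -> f (u - v) = f u - f v.
Proof. by move=> h; rewrite linear_formD// linear_formN. Qed.

Lemma sublinear0 p : sublinear p -> p 0 = 0.
Proof.
move=> [_ h]; have h2 := h 2 0 (ltr0n _ 2); have := h 2^-1 0.
by rewrite invr_gt0 ltr0n => /(_ isT); move: h2; rewrite !scaler0; lra.
Qed.

Lemma sublinear_opp p x : sublinear p -> - p (- x) <= p x.
Proof.
by move=> ps; have := ps.1 x (- x); rewrite subrr sublinear0//; lra.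
Qed.

Lemma sublinearZ p t x : sublinear p -> 0 <= t -> p (t *: x) = t * p x.
Proof.
move=> ps; rewrite le_eqVlt => /predU1P[<-|t0].
  by rewrite scale0r mul0r sublinear0.
apply/eqP; rewrite eq_le ps.2//=.
have ti : 0 < t^-1 by rewrite invr_gt0.
have := ps.2 _ (t *: x) ti; rewrite scalerA mulVf ?gt_eqF// scale1r.
by rewrite ler_pdivlMl.
Qed.

(** Superadditivity comes from testing minimality on [q x = inf {p (x + t y) - t p y : t >= 0}],
    which is sublinear and below [p]: then [p x <= q x <= p (x + y) - p y]. *)
Lemma sublinear_minimal_linear (p : V -> R) : sublinear p ->
  (forall q, sublinear q -> (forall x, q x <= p x) -> forall x, p x <= q x) ->
  linear_form p.
Proof.
move=> ps pmin.
have padd x y : p (x + y) = p x + p y.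
  apply/eqP; rewrite eq_le ps.1/=.
  pose S x := [set s | exists2 t, 0 <= t & s = p (x + t *: y) - t * p y].
  have Sn x' : S x' !=set0.
    by exists (p x'), 0 => //; rewrite scale0r mul0r addr0 subr0.
  have Sb x' s : S x' s -> - p (- x') <= s.
    case=> t t0 ->; have := ps.1 (x' + t *: y) (- x').
    by rewrite addrC addKr sublinearZ//; lra.
  have Slb x' := (inf_approx _ _ (Sn x') (Sb x')).1.
  have Sap x' := (inf_approx _ _ (Sn x') (Sb x')).2.
  pose q x := inf (S x).
  have qs : sublinear q.
    split=> [u v|t u t0]; apply: le_of_approx => e e0.
      have e2 : 0 < e / 2 by rewrite divr_gt0.
      have [_ [t1 t10 ->] h1] := Sap u _ e2.
      have [_ [t2 t20 ->] h2] := Sap v _ e2.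
      have : q (u + v) <= p (u + v + (t1 + t2) *: y) - (t1 + t2) * p y.
        by apply: Slb; exists (t1 + t2) => //; rewrite addr_ge0.
      have := ps.1 (u + t1 *: y) (v + t2 *: y).
      rewrite addrACA -scalerDl => h3 h4.
      by rewrite /q in h4 *; lra.
    have et : 0 < e / t by rewrite divr_gt0.
    have [_ [t1 t10 ->] h1] := Sap u _ et.
    have h2 : q (t *: u) <= p (t *: u + (t * t1) *: y) - (t * t1) * p y.
      by apply: Slb; exists (t * t1) => //; exact: mulr_ge0 (ltW t0) t10.
    rewrite -scalerA -scalerDr (sublinearZ p _ _ ps (ltW t0)) in h2.
    apply: (le_trans h2); rewrite -[t * t1 * _]mulrA -mulrBr.
    have -> : t * q u + e = t * (inf (S u) + e / t).
      by rewrite mulrDr mulrCA divff ?mulr1// gt_eqF.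
    by rewrite ler_pM2l// ltW.
  have qp x' : q x' <= p x'.
    by apply: Slb; exists 0 => //; rewrite scale0r mul0r addr0 subr0.
  have := pmin q qs qp x.
  have : q x <= p (x + y) - p y.
    by apply: Slb; exists 1 => //; rewrite scale1r mul1r.
  by lra.
have pN x : p (- x) = - p x.
  by have := padd x (- x); rewrite subrr sublinear0//; lra.
move=> a u v; rewrite padd; congr (_ + _).
have [a0|a0] := leP 0 a; first by rewrite sublinearZ.
rewrite -[a in LHS]opprK scaleNr pN sublinearZ ?oppr_ge0 ?ltW//; lra.
Qed.

(** Zorn's lemma on the sublinear functions below [p], ordered downwards: the infimum of a chain is
    finite because every member is at least [- p (- x)] at [x], and a minimal member is linear. *)
Theorem hahn_banach (p : V -> R) : sublinear p ->
  exists2 f, linear_form f & forall x, f x <= p x.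
Proof.
move=> ps.
pose T := {q : V -> R | sublinear q /\ forall x, q x <= p x}.
pose rel (q r : T) := `[< forall x, sval r x <= sval q x >].
have [||||q qmax] := @Zorn T rel.
- by move=> q; apply/asboolP.
- move=> q r s /asboolP qr /asboolP rs; apply/asboolP => x.
  exact: le_trans (rs x) (qr x).
- move=> [q hq] [r hr] /asboolP/= qr /asboolP/= rq.
  have e : q = r by apply/funext => x; apply/eqP; rewrite eq_le qr rq.
  by subst r; congr exist; exact: Prop_irrelevance.
- move=> A Atot; have [[a0 Aa0]|A0] := pselect (A !=set0); last first.
    exists (exist _ p (conj ps (fun x => lexx (p x)))) => s As.
    by exfalso; apply: A0; exists s.
  pose S x := [set sval q x | q in A].
  have Sn x : S x !=set0 by exists (sval a0 x), a0.
  have Sb x s : S x s -> - p (- x) <= s.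
    case=> -[q [qs qp]] _ <- /=; have := sublinear_opp _ x qs.
    by have := qp (- x); lra.
  have Slb x := (inf_approx _ _ (Sn x) (Sb x)).1.
  have Sap x := (inf_approx _ _ (Sn x) (Sb x)).2.
  pose q x := inf (S x).
  have qs : sublinear q.
    split=> [u v|t u t0]; apply: le_of_approx => e e0.
      have e2 : 0 < e / 2 by rewrite divr_gt0.
      have [_ [r1 Ar1 <-] h1] := Sap u _ e2.
      have [_ [r2 Ar2 <-] h2] := Sap v _ e2.
      have [r [Ar rr1 rr2]] : exists r : T, [/\ A r,
          forall x, sval r x <= sval r1 x & forall x, sval r x <= sval r2 x].
        case: (Atot _ _ Ar1 Ar2) => /asboolP h; [exists r2|exists r1] => //.
      have h3 : q (u + v) <= sval r (u + v) by apply: Slb; exists r.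
      have := (svalP r).1.1 u v; have := rr1 u; have := rr2 v.
      by rewrite /q in h3 *; lra.
    have et : 0 < e / t by rewrite divr_gt0.
    have [_ [r Ar <-] h1] := Sap u _ et.
    have h2 : q (t *: u) <= sval r (t *: u) by apply: Slb; exists r.
    apply: (le_trans h2); apply: (le_trans ((svalP r).1.2 _ _ t0)).
    have -> : t * q u + e = t * (inf (S u) + e / t).
      by rewrite mulrDr mulrCA divff ?mulr1// gt_eqF.
    by rewrite ler_pM2l// ltW.
  have qp x : q x <= p x.
    by apply: le_trans (proj2 (svalP a0) x); apply: Slb; exists a0.
  exists (exist _ q (conj qs qp)) => s As; apply/asboolP => x /=.
  by apply: Slb; exists s.
- exists (sval q); last exact: (svalP q).2.
  apply: sublinear_minimal_linear; first exact: (svalP q).1.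
  move=> r rs rq.
  have rp x : r x <= p x by apply: le_trans (rq x) ((svalP q).2 x).
  have qr : rel q (exist _ r (conj rs rp)) by apply/asboolP.
  by move=> x; rewrite -(qmax _ qr).
Qed.

(** The function [x |-> inf {Q (t x) / t : t > 0}] is sublinear and below [Q], and finite because
    [0 <= Q 0]; Hahn-Banach applies to it. *)
Lemma convex_linear_minorant (Q : V -> R) :
  (forall x y t, 0 <= t <= 1 ->
     Q (t *: x + (1 - t) *: y) <= t * Q x + (1 - t) * Q y) ->
  0 <= Q 0 -> exists2 f, linear_form f & forall x, f x <= Q x.
Proof.
move=> Qc Q0.
have Qw x y a b : 0 < a -> 0 < b ->
    Q ((a + b)^-1 *: (a *: x + b *: y)) <= (a + b)^-1 * (a * Q x + b * Q y).
  move=> a0 b0; have ab : 0 < a + b by rewrite addr_gt0.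
  have := Qc x y (a / (a + b)).
  have -> : 1 - a / (a + b) = b / (a + b) by field; rewrite gt_eqF.
  rewrite scalerDr !scalerA mulrDr !mulrA ![_^-1 * _]mulrC; apply.
  rewrite (divr_ge0 (ltW a0) (ltW ab))/= ler_pdivrMr// mul1r lerDl.
  exact: ltW.
pose S x := [set s | exists2 t, 0 < t & s = Q (t *: x) / t].
have Sn x : S x !=set0 by exists (Q x), 1 => //; rewrite scale1r divr1.
have Sb x s : S x s -> - Q (- x) <= s.
  case=> t t0 ->; have := Qw (t *: x) (- x) 1 t ltr01 t0.
  rewrite scalerN scale1r subrr scaler0 => /(le_trans Q0).
  rewrite mul1r pmulr_rge0 ?invr_gt0 ?addr_gt0// => h.
  by rewrite ler_pdivlMr//; lra.
have Slb x := (inf_approx _ _ (Sn x) (Sb x)).1.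
have Sap x := (inf_approx _ _ (Sn x) (Sb x)).2.
pose p x := inf (S x).
have ps : sublinear p.
  split=> [u v|t u t0]; apply: le_of_approx => e e0.
    have e2 : 0 < e / 2 by rewrite divr_gt0.
    have [_ [t1 t10 ->] h1] := Sap u _ e2.
    have [_ [t2 t20 ->] h2] := Sap v _ e2.
    have t12 : 0 < t1 + t2 by rewrite addr_gt0.
    (* At this scale the argument is the convex combination of [t1 *: u] and [t2 *: v] with weights
       [t2 / (t1 + t2)] and [t1 / (t1 + t2)]. *)
    have h : p (u + v) <= Q ((t1 * t2 / (t1 + t2)) *: (u + v)) /
                          (t1 * t2 / (t1 + t2)).
      by apply: Slb; exists (t1 * t2 / (t1 + t2)) => //; rewrite !mulr_gt0 ?invr_gt0.
    apply: (le_trans h); rewrite ler_pdivrMr ?mulr_gt0 ?invr_gt0//.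
    have := Qw (t1 *: u) (t2 *: v) t2 t1 t20 t10.
    rewrite !scalerA [t2 * t1]mulrC -scalerDr scalerA [t2 + t1]addrC.
    rewrite [_^-1 * (t1 * t2)]mulrC => /le_trans; apply.
    have -> : (t1 + t2)^-1 * (t2 * Q (t1 *: u) + t1 * Q (t2 *: v)) =
      (Q (t1 *: u) / t1 + Q (t2 *: v) / t2) * (t1 * t2 / (t1 + t2)).
      by field; rewrite !gt_eqF.
    by rewrite ler_pM2r ?mulr_gt0 ?invr_gt0//; rewrite /p; lra.
  have et : 0 < e / t by rewrite divr_gt0.
  have [_ [t1 t10 ->] h1] := Sap u _ et.
  have h2 : p (t *: u) <= Q ((t1 / t) *: (t *: u)) / (t1 / t).
    by apply: Slb; exists (t1 / t) => //; rewrite divr_gt0.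
  apply: (le_trans h2); rewrite scalerA divfK ?gt_eqF//.
  have -> : Q (t1 *: u) / (t1 / t) = t * (Q (t1 *: u) / t1).
    by field; rewrite !gt_eqF.
  have -> : t * p u + e = t * (inf (S u) + e / t).
    by rewrite mulrDr mulrCA divff ?mulr1// gt_eqF.
  by rewrite ler_pM2l// ltW.
have [f fl fp] := hahn_banach p ps; exists f => // x.
apply: le_trans (fp x) _; apply: Slb.
by exists 1 => //; rewrite scale1r divr1.
Qed.

End HahnBanach.

(** * Ekeland's variational principle *)

Section NormedBasics.
Context {R : realType} {V : normedModType R}.

Definition dual_le (M : R) (f : V -> R) :=
  linear_form f /\ forall x, f x <= M * `|x|.

Definition lip (L : R) (f : V -> R) := forall x y, f x - f y <= L * `|x - y|.

Definition seq_complete := forall u : nat -> V,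
  (forall e, 0 < e -> exists N, forall n, (N <= n)%N -> `|u n - u N| <= e) ->
  exists l, forall e, 0 < e -> exists N, forall n, (N <= n)%N -> `|u n - l| <= e.

Definition seq_closed (A : set V) :=
  forall z, (forall e, 0 < e -> exists2 w, A w & `|w - z| <= e) -> A z.

Lemma dual_le_abs M f x : dual_le M f -> `|f x| <= M * `|x|.
Proof.
move=> [fl fM]; rewrite ler_norml fM andbT.
by have := fM (- x); rewrite linear_formN// normrN; lra.
Qed.

Lemma dual_le_lip M f : dual_le M f -> lip M f.
Proof. by move=> [fl fM] x y; rewrite -linear_formB. Qed.

Lemma lip_abs L f x y : lip L f -> `|f x - f y| <= L * `|x - y|.
Proof.
by move=> fL; rewrite ler_norml fL andbT; have := fL y x; rewrite distrC; lra.
Qed.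

Lemma lip_continuous L f : lip L f -> continuous f.
Proof.
move=> fL x; apply/cvgrPdist_le => e e0.
have L1 : 0 < `|L| + 1 by rewrite ltr_wpDl.
near=> y; apply: le_trans (lip_abs _ _ _ _ fL) _.
apply: (@le_trans _ _ ((`|L| + 1) * `|x - y|)).
  by rewrite ler_wpM2r// (le_trans (ler_norm L))// lerDl.
rewrite mulrC -ler_pdivlMr//.
near: y; apply: cvgr_dist_le => //; exact: divr_gt0.
Unshelve. all: by end_near. Qed.

Lemma dual_le_is_dual M f : dual_le M f -> is_dual f.
Proof. by move=> h; split; [exact: h.1|exact: (lip_continuous _ _ (dual_le_lip _ _ h))]. Qed.

(** The gauge [N] is only comparable to the norm, so that the factors of a product can be weighted
    differently. Each step moves at least halfway down to the infimum of [h] over the points that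
    Ekeland's order allows. *)
Lemma ekeland (A : set V) (N h : V -> R) (m M L b : R) (w0 : V) :
  seq_complete -> seq_closed A -> 0 < m ->
  (forall x y, N (x + y) <= N x + N y) -> (forall x, N (- x) = N x) ->
  (forall x, m * `|x| <= N x) -> (forall x, N x <= M * `|x|) ->
  lip L h -> (forall w, A w -> b <= h w) -> A w0 ->
  exists w, [/\ A w, h w + N (w - w0) <= h w0 &
                forall z, A z -> h w <= h z + N (z - w)].
Proof.
move=> Vc Ac m0 ND NN mN NM hL hb Aw0.
have N0 x : 0 <= N x by apply: le_trans (mN x); rewrite mulr_ge0// ltW.
have NB x y z : N (x - z) <= N (x - y) + N (y - z).
  by apply: le_trans (ND _ _); rewrite addrA subrK.
have [step Hstep] : exists s : V -> V, forall w, A w -> [/\ A (s w),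
    h (s w) + N (s w - w) <= h w &
    forall z, A z -> h z + N (z - w) <= h w -> 2 * h (s w) <= h z + h w].
  suff /choice[s Hs] : forall w, exists z, A w -> [/\ A z, h z + N (z - w) <= h w &
    forall z', A z' -> h z' + N (z' - w) <= h w -> 2 * h z <= h z' + h w].
    by exists s.
  move=> w; have [Aw|nAw] := pselect (A w); last by exists w.
  pose S := [set h z | z in [set z | A z /\ h z + N (z - w) <= h w]].
  have Nw : N (w - w) <= 0.
    by rewrite subrr; apply: le_trans (NM 0) _; rewrite normr0 mulr0.
  have Sn : S !=set0 by exists (h w), w => //; split=> //; lra.
  have Sb s : S s -> b <= s by case=> z [/hb ? _] <-.
  have [lb ap] := inf_approx _ _ Sn Sb.
  have [hw|hw] := leP (h w) (inf S).
    exists w => _; split=> // [|z Az hz]; first by lra.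
    by have := lb (h z); rewrite /S/= => /(_ (ex_intro2 _ _ z (conj Az hz) erefl)); lra.
  have e0 : 0 < (h w - inf S) / 2 by rewrite divr_gt0// subr_gt0.
  have [_ [z [Az hz] <-] hz2] := ap _ e0.
  exists z => _; split=> // z' Az' hz'.
  by have := lb (h z'); rewrite /S/= => /(_ (ex_intro2 _ _ z' (conj Az' hz') erefl)); lra.
pose u n := iter n step w0.
have Au n : A (u n) by elim: n => //= n /Hstep[].
have un n k : h (u (n + k)%N) + N (u (n + k)%N - u n) <= h (u n).
  elim: k => [|k IH].
    rewrite addn0 subrr; have := NM 0; rewrite normr0 mulr0; lra.
  have [_ + _] := Hstep _ (Au (n + k)%N); rewrite addnS /=.
  have := NB (step (u (n + k)%N)) (u (n + k)%N) (u n).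
  by lra.
have unm n k : (n <= k)%N -> h (u k) + N (u k - u n) <= h (u n).
  by move=> nk; have := un n (k - n)%N; rewrite subnKC.
pose S := range (h \o u).
have Sn : S !=set0 by exists (h (u 0%N)), 0%N.
have Sb s : S s -> b <= s by case=> n _ <-; exact: hb.
have [lb ap] := inf_approx _ _ Sn Sb.
have lbn n : inf S <= h (u n) by apply: lb; exists n.
have [l ul] : exists l, forall e, 0 < e ->
    exists K, forall n, (K <= n)%N -> `|u n - l| <= e.
  apply: Vc => e e0; have [_ [K _ <-] hK] := ap _ (mulr_gt0 m0 e0).
  exists K => n Kn; rewrite -(ler_pM2l m0); apply: le_trans (mN _) _.
  by have := unm _ _ Kn; have := lbn n; move: hK; rewrite /=; lra.
have Al : A l.
  by apply: Ac => e /ul[K hK]; exists (u K) => //; exact: hK.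
pose B := 1 + `|L| + `|M|.
have B0 : 0 < B by rewrite /B -addrA ltr_wpDr// addr_ge0.
have hl n : h l + N (l - u n) <= h (u n).
  apply: le_of_approx => e e0.
  have [K hK] := ul (e / B) (divr_gt0 e0 B0).
  have := hK (maxn K n) (leq_maxl _ _); have := unm n (maxn K n) (leq_maxr _ _).
  set k := maxn K n => h1 h2.
  have h3 := hL l (u k); have h4 := NB l (u k) (u n); have h5 := NM (l - u k).
  rewrite distrC in h3 h5.
  have h6 : (L + M) * `|u k - l| <= e.
    apply: (@le_trans _ _ (B * `|u k - l|)).
      rewrite ler_wpM2r//; have := ler_norm L; have := ler_norm M.
      by rewrite /B; lra.
    by rewrite mulrC -ler_pdivlMr.
  by rewrite mulrDl in h6; lra.
exists l; split=> // [|z Az]; first exact: (hl 0%N).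
rewrite leNgt; apply/negP => hz.
(* A point [z] violating minimality at [l] stays admissible at every stage, so the halving rule
   brings the infimum of the [h (u n)] down to [h z], whereas [h l] is at most that infimum. *)
have hzn n : 2 * h (u n.+1) <= h z + h (u n).
  have [_ _] := Hstep _ (Au n); apply => //.
  by have := NB z l (u n); have := hl n; lra.
have : inf S <= h z.
  apply: le_of_approx => e e0; have [_ [n _ <-] /= hn] := ap _ e0.
  by have := hzn n; have := lbn n.+1; lra.
have : h l <= inf S.
  apply: lb_le_inf => // _ [n _ <-] /=.
  by have := hl n; have := N0 (l - u n); lra.
by have := N0 (z - l); lra.
Qed.

End NormedBasics.

Arguments seq_complete {R} V.

Lemma complete_seq_complete {R : realType} (V : completeNormedModType R) :
  seq_complete V.
Proof.
move=> u uc.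
have ul : cvg (u @ \oo).
  apply/cauchy_cvgP/cauchy_exP => e e0.
  have [N hN] := uc (e / 2) (divr_gt0 e0 (ltr0n _ 2)).
  exists (u N); exists N => // n /= Nn; rewrite -ball_normE /ball_/= distrC.
  by apply: le_lt_trans (hN n Nn) _; lra.
exists (lim (u @ \oo)) => e e0.
have /cvgrPdist_le/(_ e e0)[N _ hN] := ul.
by exists N => n Nn; rewrite distrC; exact: hN.
Qed.

(** The product carries the maximum norm, while coderivatives are measured with the sum of the
    norms; these bounds convert between the two. *)
Lemma prod_norm_le {R : realType} (X Y : normedModType R) (z : X * Y) :
  [/\ `|z.1| <= `|z|, `|z.2| <= `|z| & `|z| <= `|z.1| + `|z.2| ].
Proof.
rewrite prod_normE; split; rewrite ?le_max ?lexx ?orbT//.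
by rewrite ge_max; apply/andP; split; rewrite ?lerDl ?lerDr.
Qed.

Lemma prod_seq_complete {R : realType} (X Y : normedModType R) :
  seq_complete X -> seq_complete Y -> seq_complete (X * Y)%type.
Proof.
move=> Xc Yc u uc.
have [l1 h1] : exists l : X, forall e, 0 < e ->
    exists N, forall n, (N <= n)%N -> `|(u n).1 - l| <= e.
  apply: Xc => e /uc[N hN]; exists N => n /hN.
  by apply: le_trans; have [h _ _] := prod_norm_le _ _ (u n - u N).
have [l2 h2] : exists l : Y, forall e, 0 < e ->
    exists N, forall n, (N <= n)%N -> `|(u n).2 - l| <= e.
  apply: Yc => e /uc[N hN]; exists N => n /hN.
  by apply: le_trans; have [_ h _] := prod_norm_le _ _ (u n - u N).
exists (l1, l2) => e e0.
have e2 : 0 < e / 2 by rewrite divr_gt0.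
have [N1 k1] := h1 _ e2; have [N2 k2] := h2 _ e2.
exists (maxn N1 N2) => n; rewrite geq_max => /andP[/k1 a /k2 b].
have [_ _ /=] := prod_norm_le _ _ (u n - (l1, l2)); lra.
Qed.

(** * Countable covers of dual balls of Asplund spaces *)

Section CountableCover.
Context {R : realType} {V : normedModType R} {I : countType}.
Variables (e : I -> V) (eps : R).

(** The centres [F k] need not be linear, since only their values at the [e i] matter; any function
    can fill the spare indices of an enumeration. *)
Definition countably_covered (A : set (V -> R)) :=
  exists F : nat -> V -> R, forall f, A f ->
    exists k, forall i, `|f (e i) - F k (e i)| <= eps * `|e i|.

Lemma countably_coveredS A B : A `<=` B ->
  countably_covered B -> countably_covered A.
Proof. by move=> AB [F FB]; exists F => f /AB/FB. Qed.

Lemma countably_covered_bigcup (J : countType) (A : J -> set (V -> R)) :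
  (forall j, countably_covered (A j)) -> countably_covered (\bigcup_j A j).
Proof.
move=> /choice[F HF].
exists (fun n => if unpickle n is Some jk then F jk.1 jk.2 else cst 0).
move=> f [j _ /HF[k hk]]; exists (pickle (j, k)) => i.
by rewrite pickleK.
Qed.

Lemma countably_coveredU A B : countably_covered A -> countably_covered B ->
  countably_covered (A `|` B).
Proof.
move=> Ac Bc; have : countably_covered (\bigcup_b (if b then A else B)).
  by apply: countably_covered_bigcup => -[].
apply: countably_coveredS => f [Af|Bf]; first by exists true.
by exists false.
Qed.

End CountableCover.

Lemma differentiable_upper {R : realType} (V : normedModType R) (f : V -> R) x :
  differentiable f x -> exists2 d : V -> R, linear_form d &
  forall eta, 0 < eta -> exists2 rho, 0 < rho &
    forall h, `|h| <= rho -> f (x + h) <= f x + d h + eta * `|h|.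
Proof.
move=> df; exists ('d f x); first by move=> a u v; rewrite linearP.
move=> eta eta0.
have /eqaddoP/(_ eta eta0)/nbhs_normP[d /= d0 hd] := diff_locally df.
exists (d / 2); first by rewrite divr_gt0.
move=> h hh.
have : `|(f \o shift x - (cst (f x) + 'd f x)) h| <= eta * `|h|.
  by apply: hd; rewrite /ball_/= sub0r normrN; lra.
move=> /(le_trans (ler_norm _)).
rewrite -[X in X <= _]/(f (h + x) - (f x + 'd f x h)) [h + x]addrC; lra.
Qed.

Theorem asplund_dual_covered {R : realType} (V : completeNormedModType R)
    (I : countType) (e : I -> V) (eps M : R) :
  asplund V -> 0 < eps -> 0 <= M ->
  countably_covered e eps [set f | dual_le M f].
Proof.
move=> VA eps0 M0; apply: contrapT => ncov.
pose C z := [set c | countably_covered e eps [set f | dual_le M f /\ c < f z]].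
have Cn z : C z !=set0.
  exists (M * `|z|), (fun _ => cst 0) => f [fM]; rewrite ltNge.
  by rewrite (fM.2 z).
(* Below [- (M * |z|)] the superlevel set is the whole ball, assumed not covered; so the infimum
   [p z] is finite. *)
have Cb z c : C z c -> - (M * `|z|) <= c.
  move=> Cc; rewrite leNgt; apply/negP => h; apply: ncov.
  apply: countably_coveredS Cc => f fM; split=> //.
  by apply: lt_le_trans h _; have := dual_le_abs _ _ z fM; rewrite ler_norml => /andP[].
have plb z := (inf_approx _ _ (Cn z) (Cb z)).1.
have pap z := (inf_approx _ _ (Cn z) (Cb z)).2.
pose p z := inf (C z).
have p_covered z t : 0 < t -> C z (p z + t).
  move=> /(pap z)[c Cc ct]; apply: countably_coveredS Cc => f [fM h]; split=> //.
  exact: lt_trans h.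
have plip : lip M p.
  move=> x y; rewrite lerBlDl; apply: le_of_approx => t t0.
  rewrite -addrA -addrCA [_ + (p y + t)]addrC; apply: plb.
  apply: countably_coveredS (p_covered y t t0) => f [fM h]; split=> //.
  by have := dual_le_lip _ _ fM x y; lra.
have psub : sublinear p.
  split=> [x y|t x t0]; apply: le_of_approx => s s0.
    have s2 : 0 < s / 2 by rewrite divr_gt0.
    have -> : p x + p y + s = (p x + s / 2) + (p y + s / 2) by lra.
    apply: plb.
    apply: countably_coveredS
      (countably_coveredU _ _ _ _ (p_covered x _ s2) (p_covered y _ s2)).
    move=> f [fM]; rewrite (linear_formD f x y fM.1).
    have [h1|h1] := ltP (p x + s / 2) (f x); first by left.
    by move=> h2; right; split=> //; lra.
  have -> : t * p x + s = t * (p x + s / t) by field; rewrite gt_eqF.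
  apply: plb.
  apply: countably_coveredS (p_covered x (s / t) (divr_gt0 s0 t0)).
  move=> f [fM]; rewrite (linear_formZ f t x fM.1).
  by rewrite ltr_pM2l.
have pconv : convex_fun_on setT p.
  move=> x y t _ _ /andP[t0 t1]; apply: le_trans (psub.1 _ _) _.
  have t1' : 0 <= 1 - t by rewrite subr_ge0.
  by rewrite (sublinearZ p _ _ psub t0) (sublinearZ p _ _ psub t1').
have [W [_ [Wdense Wdiff]]] := VA setT p openT (fun _ _ _ _ _ _ => Logic.I)
  (continuous_subspaceT (lip_continuous _ _ plip)) pconv.
have [z [/Wdiff zdiff _]] := Wdense 0 Logic.I _ (filterT (F := nbhs (0 : V))).
have [d dl hd] := differentiable_upper _ _ _ zdiff.
have [rho rho0 {}hd] := hd (eps / 3) (divr_gt0 eps0 (ltr0n _ 3)).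
pose t := eps / 3 * rho.
have t0 : 0 < t by rewrite mulr_gt0// divr_gt0.
have : ~ C z (p z - t).
  by move=> /plb; rewrite -/(p z); lra.
apply.
(* Test increments of norm [rho] along each nonzero [e i], with both signs. The functionals
   exceeding [p + t] at one of these points form a countable union of covered sets. *)
pose h (ib : I * bool) := ((-1) ^+ ib.2 * (rho / `|e ib.1|)) *: e ib.1.
pose B ib := [set f | dual_le M f /\ p (z + h ib) + t < f (z + h ib)].
have Bcov : countably_covered e eps (\bigcup_ib B ib).
  by apply: countably_covered_bigcup => ib; exact: p_covered.
have dcov : countably_covered e eps
    [set f | forall i, `|f (e i) - d (e i)| <= eps * `|e i| ].
  by exists (fun _ => d) => f hf; exists 0%N.
apply: countably_coveredS (countably_coveredU _ _ _ _ Bcov dcov).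
move=> f [fM fz].
have [fB|fB] := pselect ((\bigcup_ib B ib) f); [by left|right] => i.
have [ei0|ei0] := eqVneq (e i) 0.
  by rewrite ei0 (linear_form0 f fM.1) (linear_form0 d dl) subrr !normr0 mulr0.
have ne : 0 < `|e i| by rewrite normr_gt0.
(* Outside that union [f (z + h) <= p (z + h) + t]; moreover [p (z + h) <= p z + d h + t] and
   [f z > p z - t]. The total error [3 t = eps * rho] is what the tolerance [eps] allows. *)
have key b : f (h (i, b)) <= d (h (i, b)) + 3 * t.
  have fle : f (z + h (i, b)) <= p (z + h (i, b)) + t.
    by rewrite leNgt; apply/negP => hlt; apply: fB; exists (i, b).
  have nh : `|h (i, b)| = rho.
    rewrite /h/= normrZ normrM normr_sign mul1r ger0_norm ?divfK ?gt_eqF//.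
    by rewrite divr_ge0// ltW.
  have := hd (h (i, b)); rewrite nh lexx => /(_ isT).
  by rewrite (linear_formD f _ _ fM.1) in fle; rewrite -/t; lra.
have k1 := key false; have k2 := key true.
rewrite /h/= expr0 expr1 mul1r mulN1r !(linear_formZ f _ _ fM.1) !(linear_formZ d _ _ dl) in k1 k2.
have re0 : 0 < rho / `|e i| by rewrite divr_gt0.
have tE : 3 * t = rho / `|e i| * (eps * `|e i|).
  by rewrite /t; field; rewrite gt_eqF.
rewrite ler_norml; apply/andP; split; rewrite -(ler_pM2l re0).
  by rewrite mulrN -tE mulrBr; rewrite !mulNr in k2; lra.
by rewrite -tE mulrBr; lra.
Qed.

(** The consequence of the Asplund property that is carried from [X] and [Y] to their product. *)
Definition dual_covered {R : realType} (V : normedModType R) :=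
  forall (I : countType) (e : I -> V) (eps M : R), 0 < eps -> 0 <= M ->
    countably_covered e eps [set f | dual_le M f].

(** A functional splits as [f (x, 0) + f (0, y)], and the product norm dominates both coordinates,
    so pairs of centres with tolerance [eps / 2] suffice. *)
Lemma prod_dual_covered {R : realType} (X Y : normedModType R) :
  dual_covered X -> dual_covered Y -> dual_covered (X * Y)%type.
Proof.
move=> hX hY I e eps M eps0 M0.
have e2 : 0 < eps / 2 by rewrite divr_gt0.
have [F HF] := hX I (fst \o e) (eps / 2) M e2 M0.
have [G HG] := hY I (snd \o e) (eps / 2) M e2 M0.
exists (fun n => if unpickle n is Some kl then
   fun z => F kl.1 z.1 + G kl.2 z.2 else cst 0).
move=> f [fl fM].
have fs (z : X * Y) : f z = f (z.1, 0) + f (0, z.2).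
  by rewrite -linear_formD// /GRing.add/= /add_pair/= addr0 add0r -surjective_pairing.
have [|k hk] := HF (fun x => f (x, 0)).
  split=> [a u v|x].
    by rewrite -fl; congr f; congr pair; rewrite /= scaler0 addr0.
  have := fM (x, 0); rewrite prod_normE/= normr0.
  by rewrite (elimT max_idPl).
have [|l hl] := HG (fun y => f (0, y)).
  split=> [a u v|y].
    by rewrite -fl; congr f; congr pair; rewrite /= scaler0 addr0.
  have := fM (0, y); rewrite prod_normE/= normr0.
  by rewrite (elimT max_idPr).
exists (pickle (k, l)) => i; rewrite pickleK/= fs.
have [h1 h2 _] := prod_norm_le _ _ (e i).
have := ler_normD (f ((e i).1, 0) - F k (e i).1) (f (0, (e i).2) - G l (e i).2).
rewrite addrACA -opprD => /le_trans; apply.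
apply: le_trans (lerD (hk i) (hl i)) _.
by have := ler_wpM2l (ltW e2) h1; have := ler_wpM2l (ltW e2) h2; rewrite /=; lra.
Qed.

(** * A smooth maximum *)

(** From [expR (- s) >= 1 - s] follows [expR s <= 1 / (1 - s)], and [(1 + s + 2 s^2) (1 - s) = 1 +
    s^2 (1 - 2 s)]. *)
Lemma expR_le_quadratic {R : realType} (s : R) :
  s <= 2^-1 -> expR s <= 1 + s + 2 * s ^+ 2.
Proof.
move=> hs; have h1 : 0 < 1 - s by lra.
have h2 := expR_ge1Dx (- s); have h3 := expR_gt0 s.
have h4 : expR s * expR (- s) = 1 by rewrite expRN divff ?gt_eqF.
have h5 : expR s * (1 - s) <= 1 by rewrite -h4 ler_pM2l//; lra.
rewrite -(ler_pM2r h1); apply: le_trans h5 _.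
have h6 : 0 <= s ^+ 2 * (1 - 2 * s) by rewrite mulr_ge0 ?sqr_ge0//; lra.
by rewrite -subr_ge0; apply: le_trans h6 _; rewrite le_eqVlt; apply/orP; left;
  apply/eqP; ring.
Qed.

(* Witness: [q |-> ln (\sum_i expR (N * q i)) / N] for [N] large. *)
Lemma smooth_max {R : realType} (m : nat) (tau : R) : 0 < tau ->
  exists (S : ('I_m.+1 -> R) -> R) (B : R), 0 < B /\
  [/\ forall q i, q i <= S q,
      forall q b, (forall i, q i <= b) -> S q <= b + tau,
      forall q q' t, (forall i, q' i <= q i + t) -> S q' <= S q + t &
      forall q, exists lam : 'I_m.+1 -> R, [/\ forall i, 0 <= lam i,
        \sum_i lam i = 1, S q <= \sum_i lam i * q i + tau &
        forall q' d, (forall i, `|q' i - q i| <= d) -> B * d <= 1 ->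
          S q' - S q <= \sum_i lam i * (q' i - q i) + B * d ^+ 2]].
Proof.
move=> tau0; pose lm : R := ln m.+1%:R.
have lm0 : 0 <= lm by rewrite ln_ge0// ler1n.
(* Log-sum-exp exceeds the maximum by at most [ln m.+1 / N]; the extra [1] keeps [N] positive when
   [m = 0]. *)
pose N := (1 + lm) / tau.
have N0 : 0 < N by rewrite divr_gt0// ltr_pwDl.
have lmN : lm / N <= tau.
  rewrite ler_pdivrMr// /N mulrCA divff ?mulr1 ?gt_eqF//; lra.
pose E (q : 'I_m.+1 -> R) := \sum_i expR (N * q i).
have E0 q : 0 < E q.
  rewrite /E big_ord_recl ltr_wpDr ?expR_gt0//.
  by apply: sumr_ge0 => i _; exact: expR_ge0.
pose S q := ln (E q) / N.
have NS q : expR (N * S q) = E q.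
  by rewrite /S mulrCA divff ?gt_eqF// mulr1 lnK ?posrE.
have Sle q b : E q <= expR (N * b) -> S q <= b.
  by rewrite -NS ler_expR ler_pM2l.
have leS q b : expR (N * b) <= E q -> b <= S q.
  by rewrite -NS ler_expR ler_pM2l.
exists S, (2 * N); split; first by rewrite mulr_gt0.
split.
- move=> q i; apply: leS; rewrite /E (bigD1 i)//= lerDl.
  by apply: sumr_ge0 => j _; exact: expR_ge0.
- move=> q b qb; apply: le_trans (_ : b + lm / N <= _); last by rewrite lerD2l.
  apply: Sle; rewrite mulrDr mulrCA divff ?gt_eqF// mulr1 expRD lnK ?posrE ?ltr0n//.
  apply: (@le_trans _ _ (\sum_(i < m.+1) expR (N * b))).
    by apply: ler_sum => i _; rewrite ler_expR ler_pM2l.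
  by rewrite sumr_const card_ord mulr_natr.
- move=> q q' t qt; apply: Sle; rewrite mulrDr expRD NS /E mulr_suml.
  by apply: ler_sum => i _; rewrite -expRD ler_expR -mulrDr ler_pM2l.
(* The weights are the gradient of log-sum-exp at [q]. *)
move=> q; pose lam i := expR (N * (q i - S q)).
have lam0 i : 0 < lam i by exact: expR_gt0.
have lamE i : lam i = expR (N * q i) / E q by rewrite /lam mulrBr expRB NS.
have lam1 : \sum_i lam i = 1.
  under eq_bigr do rewrite lamE.
  by rewrite -mulr_suml -/(E q) divff ?gt_eqF.
exists lam; split=> // [i||q' d qd dB]; first exact: ltW.
- apply: le_trans (_ : _ <= \sum_i lam i * q i + lm / N) _; last by rewrite lerD2l.
  rewrite -lerBlDl -(ler_pM2l N0) [leRHS]mulrCA divff ?gt_eqF// mulr1.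
  (* Entropy bound: [1 + x <= expR x] with [x = N (S q - q i) - lm], weighted by [lam i] and summed,
     controls the gap between [S q] and the weighted mean. *)
  have h i : lam i * (1 + (N * (S q - q i) - lm)) <= m.+1%:R^-1.
    apply: (@le_trans _ _ (lam i * expR (N * (S q - q i) - lm))).
      by rewrite ler_pM2l// expR_ge1Dx.
    rewrite -expRD [X in expR X](_ : _ = - lm); last by ring.
    by rewrite expRN lnK ?posrE ?ltr0n.
  have : \sum_i lam i * (1 + (N * (S q - q i) - lm)) <= \sum_(i < m.+1) m.+1%:R^-1.
    by apply: ler_sum => i _; exact: h.
  rewrite sumr_const card_ord -[_ *+ _]mulr_natr mulVf ?pnatr_eq0//.
  have -> : \sum_i lam i * (1 + (N * (S q - q i) - lm)) =
      (1 + (N * S q - lm)) * \sum_i lam i - N * \sum_i lam i * q i.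
    rewrite !mulr_sumr -sumrB; apply: eq_bigr => i _; ring.
  by rewrite lam1 mulr1 mulrBr; lra.
have d0 : 0 <= d by apply: le_trans (qd ord0).
(* Since [B = 2 N], the condition [B * d <= 1] puts [N (q' i - q i)] in the range of the quadratic
   bound for [expR]. *)
have hN : N * (S q' - S q) <= N * (\sum_i lam i * (q' i - q i) + 2 * N * d ^+ 2).
  have h1 : expR (N * (S q' - S q)) = \sum_i lam i * expR (N * (q' i - q i)).
    rewrite mulrBr expRB !NS {1}/E mulr_suml; apply: eq_bigr => i _.
    by rewrite lamE [RHS]mulrAC -expRD; congr (expR _ / _); ring.
  have h2 : \sum_i lam i * expR (N * (q' i - q i)) <=
      \sum_i (lam i * (1 + N * (q' i - q i) + 2 * (N * d) ^+ 2)).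
    apply: ler_sum => i _; rewrite ler_pM2l//.
    have := qd i; rewrite ler_norml => /andP[qd1 qd2].
    have k1 : N * (q' i - q i) <= N * d by rewrite ler_pM2l.
    have k2 : - (N * d) <= N * (q' i - q i) by rewrite -mulrN ler_pM2l.
    apply: le_trans (expR_le_quadratic _ _) _; first by lra.
    rewrite lerD2l ler_pM2l// -[leLHS]real_normK ?num_real//.
    rewrite lerXn2r ?nnegrE//; first by rewrite mulr_ge0// ltW.
    by rewrite ler_norml k1 k2.
  have h3 : \sum_i (lam i * (1 + N * (q' i - q i) + 2 * (N * d) ^+ 2)) =
      (1 + 2 * (N * d) ^+ 2) * \sum_i lam i + N * \sum_i lam i * (q' i - q i).
    rewrite !mulr_sumr -big_split; apply: eq_bigr => i _ /=; ring.
  rewrite h3 lam1 mulr1 -h1 in h2.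
  have h4 := expR_ge1Dx (N * (S q' - S q)).
  have h5 : N * (2 * N * d ^+ 2) = 2 * (N * d) ^+ 2 by ring.
  rewrite [leRHS]mulrDr h5; lra.
by move: hN; rewrite ler_pM2l.
Qed.

(** * Fuzzy sum rule on small sets *)

Lemma sup_approx {R : realType} (S : set R) (b : R) :
  S !=set0 -> (forall s, S s -> s <= b) ->
  (forall s, S s -> s <= sup S) /\
  (forall e, 0 < e -> exists2 s, S s & sup S - e < s).
Proof.
move=> S0 ub; have hub : has_ubound S by exists b => s /ub.
split=> [s Ss|e e0]; first exact: ub_le_sup.
by have [s Ss se] := sup_adherent e0 (conj S0 hub); exists s.
Qed.

(** Divide by [t] and let [t] grow: this removes additive errors from inequalities between
    positively homogeneous quantities. *)
Lemma le_of_scaling {R : realType} (a b c : R) :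
  (forall t, 0 < t -> t * a <= t * b + c) -> a <= b.
Proof.
move=> h; apply: le_of_approx => e e0.
have t0 : 0 < (`|c| + 1) / e by rewrite divr_gt0// ltr_wpDl.
rewrite -(ler_pM2l t0); apply: le_trans (h _ t0) _.
rewrite mulrDr lerD2l divfK ?gt_eqF//; have := ler_norm c; lra.
Qed.

Section MinorantPieces.
Context {R : realType} {V : normedModType R}.

(** The labels [cl] express separability, up to [eps], of the dual balls restricted to [A], in the
    Lipschitz seminorm. *)
Definition dual_small_on (A : set V) := forall eps M : R, 0 < eps -> 0 <= M ->
  exists cl : (V -> R) -> nat, forall f f', dual_le M f -> dual_le M f' ->
    cl f = cl f' -> forall x y, A x -> A y -> f (x - y) - f' (x - y) <= eps * `|x - y|.

Lemma dual_small_onS (A B : set V) : A `<=` B -> dual_small_on B -> dual_small_on A.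
Proof.
move=> AB hB eps M e0 M0; have [cl hcl] := hB eps M e0 M0.
by exists cl => f f' hf hf' ff' x y /AB Bx /AB By; exact: hcl.
Qed.

Lemma convex_subgradient (g : V -> R) (L : R) z :
  convex_fun_on setT g -> lip L g ->
  exists2 f, dual_le L f & forall x, g z + f (x - z) <= g x.
Proof.
move=> gc gL.
have [||f fl fle] := convex_linear_minorant (fun h => g (z + h) - g z).
- move=> x y t ht.
  have -> : z + (t *: x + (1 - t) *: y) = t *: (z + x) + (1 - t) *: (z + y).
    by rewrite !scalerDr addrACA -scalerDl [t + _]addrC subrK scale1r.
  by have := gc (z + x) (z + y) t Logic.I Logic.I ht; lra.
- by rewrite addr0 subrr.
exists f; first split=> // x.
  apply: le_trans (fle x) _; apply: le_trans (gL _ _) _.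
  by rewrite [z + x]addrC addrK.
by move=> x; have := fle (x - z); rewrite [z + _]addrC subrK; lra.
Qed.

(** Comparing the affine minorant with [g] at [t *: h] for large [t] leaves only the slopes. *)
Lemma minorant_slope (g f l : V -> R) (b s : R) h :
  linear_form f -> linear_form l -> (forall z, f z - b <= g z) ->
  lip s (fun z => g z - l z) -> f h <= l h + s * `|h|.
Proof.
move=> fl ll fg gl; apply: (@le_of_scaling _ _ _ (g 0 + b)) => t t0.
have := fg (t *: h); have := gl (t *: h) 0.
rewrite subr0 (linear_form0 l ll) (linear_formZ l t h ll) (linear_formZ f t h fl).
by rewrite normrZ (gtr0_norm t0) mulrCA; lra.
Qed.

(** [g] is the supremum of its affine minorants, and [p k] the supremum of those with label [k].
    Slopes with one label agree up to [eps] on [A], so any one of them describes the increments of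
    [p k] there. The third clause hands down to each piece the estimates of [g] relative to a linear
    form. *)
Lemma minorant_pieces (A : set V) (g : V -> R) (L eps : R) :
  dual_small_on A -> convex_fun_on setT g -> lip L g -> 0 <= L -> 0 < eps ->
  exists p : nat -> V -> R,
  [/\ forall k z, p k z <= g z, forall z, exists k, p k z = g z,
      forall k l s x y, linear_form l -> lip s (fun z => g z - l z) ->
        p k x - p k y <= l (x - y) + s * `|x - y| &
      forall k z t, 0 < t -> exists f b,
        [/\ dual_le L f, forall x, f x - b <= g x, p k z - t <= f z - b &
            forall x y, A x -> A y -> p k x - p k y <= f (x - y) + eps * `|x - y| ]].
Proof.
move=> Asm gc gL L0 eps0; have [cl hcl] := Asm eps L eps0 L0.
pose minor (fb : (V -> R) * R) := dual_le L fb.1 /\ forall x, fb.1 x - fb.2 <= g x.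
have subg z : exists2 fb, minor fb & fb.1 z - fb.2 = g z.
  have [f fL fg] := convex_subgradient g L z gc gL.
  exists (f, f z - g z); last by rewrite /=; lra.
  by split=> // x /=; have := fg x; rewrite (linear_formB f _ _ fL.1); lra.
have [fb0 m0 _] := subg 0.
(* An empty class receives the fixed minorant [fb0], so that every supremum is over a nonempty
   set. *)
pose T k := [set fb | minor fb /\ (cl fb.1 = k \/
  fb = fb0 /\ ~ exists2 fb', minor fb' & cl fb'.1 = k)].
have Tn k : exists fb, T k fb.
  have [[fb' h1 h2]|h] := pselect (exists2 fb', minor fb' & cl fb'.1 = k).
    by exists fb'; split=> //; left.
  by exists fb0; split=> //; right.
have Tclose k fb fb' : T k fb -> T k fb' -> forall x y, A x -> A y ->
    fb.1 (x - y) - fb'.1 (x - y) <= eps * `|x - y|.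
  move=> [m [c|[-> no]]] [m' [c'|[-> no']]] x y Ax Ay.
  - by apply: hcl => //; [exact: m.1|exact: m'.1|rewrite c c'].
  - by exfalso; apply: no'; exists fb.
  - by exfalso; apply: no; exists fb'.
  - by rewrite subrr mulr_ge0// ltW.
pose S k z := [set fb.1 z - fb.2 | fb in T k].
have Sn k z : S k z !=set0 by have [fb h] := Tn k; exists (fb.1 z - fb.2), fb.
have Sb k z s : S k z s -> s <= g z by case=> fb [m _] <-; exact: m.2.
have Sub k z fb : T k fb -> fb.1 z - fb.2 <= sup (S k z).
  by move=> h; apply: (sup_approx _ _ (Sn k z) (Sb k z)).1; exists fb.
have Sap k z t : 0 < t -> exists2 fb, T k fb & sup (S k z) - t < fb.1 z - fb.2.
  move=> /(sup_approx _ _ (Sn k z) (Sb k z)).2[_ [fb h <-] ?].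
  by exists fb.
exists (fun k z => sup (S k z)); split.
- by move=> k z; apply: ge_sup => // s; exact: Sb.
- move=> z; have [fb mfb e] := subg z; exists (cl fb.1).
  apply/eqP; rewrite eq_le; apply/andP; split.
    by apply: ge_sup => // s; exact: Sb.
  by rewrite -e; apply: Sub; split=> //; left.
- move=> k l s x y ll gl; rewrite lerBlDl; apply: le_of_approx => t t0.
  have [fb Tfb h] := Sap k x t t0; have := Sub k y fb Tfb.
  have := minorant_slope g fb.1 l fb.2 s (x - y) Tfb.1.1.1 ll Tfb.1.2 gl.
  by rewrite (linear_formB fb.1 _ _ Tfb.1.1.1); lra.
move=> k z t t0; have [fb Tfb h] := Sap k z t t0.
exists fb.1, fb.2; split.
- exact: Tfb.1.1.
- exact: Tfb.1.2.
- exact: ltW.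
move=> x y Ax Ay; rewrite lerBlDl; apply: le_of_approx => u u0.
have [fb' Tfb' h'] := Sap k x u u0; have := Sub k y fb' Tfb'.
have := Tclose k fb' fb Tfb' Tfb x y Ax Ay.
by rewrite (linear_formB fb'.1 _ _ Tfb'.1.1.1); lra.
Qed.

Lemma lip_norm (k : R) (w : V) : 0 <= k -> lip k (fun z => k * `|z - w|).
Proof.
move=> k0 x y; rewrite -mulrBr ler_wpM2l//.
by have := ler_normD (x - y) (y - w); rewrite addrA subrK; lra.
Qed.

End MinorantPieces.

Section FuzzyStep.
Context {R : realType} {V : normedModType R}.

Lemma linear_form_sum (m : nat) (lam : 'I_m -> R) (f : 'I_m -> V -> R) :
  (forall i, linear_form (f i)) -> linear_form (fun x => \sum_i lam i * f i x).
Proof.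
move=> fl a u v; rewrite mulr_sumr -big_split; apply: eq_bigr => i _ /=.
by rewrite fl; ring.
Qed.

Lemma convex_comb_le (m : nat) (lam x y : 'I_m -> R) :
  (forall i, 0 <= lam i) -> (forall i, x i <= y i) ->
  \sum_i lam i * x i <= \sum_i lam i * y i.
Proof. by move=> l0 xy; apply: ler_sum => i _; exact: ler_wpM2l. Qed.

Lemma convex_combDc (m : nat) (lam x : 'I_m -> R) c :
  \sum_i lam i = 1 -> \sum_i lam i * (x i + c) = \sum_i lam i * x i + c.
Proof.
move=> l1; rewrite -[c in RHS]mulr1 -l1 mulr_sumr -big_split.
by apply: eq_bigr => i _ /=; ring.
Qed.

(** Ekeland's principle is used twice: for the supremum [gt] of the shifted pieces, giving [w1],
    then near [w1] for the smooth maximum [G] of finitely many of them. The functional is minus a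
    convex combination of slopes. The last clause holds on all of [A] and keeps control of an
    earlier functional when the construction is iterated. *)
Lemma fuzzy_step (A : set V) (g : V -> R) (L eps eta : R) (wb : V) :
  seq_complete V -> seq_closed A -> dual_small_on A ->
  convex_fun_on setT g -> lip L g -> 0 <= L ->
  A wb -> (forall z, A z -> g wb <= g z) -> 0 < eps -> 0 < eta ->
  exists w f d, [/\ A w, `|w - wb| <= eta, dual_le L f & 0 < d] /\
  [/\ forall z, A z -> `|z - w| <= d -> f (z - w) <= eps * `|z - w|,
      forall h, - f h <= g (wb + h) - g wb + eta &
      forall l s, linear_form l -> 0 <= s -> s <= L ->
        lip s (fun z => g z - l z) ->
        forall z, A z -> - l (z - w) <= (s + eps) * `|z - w| ].
Proof.
move=> Vc Ac Asm gc gL L0 Awb gmin eps0 eta0.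
(* Four errors of size [k1] add up to [eps]: the penalty in [h], the second Ekeland perturbation,
   the pieces, and the remainder of [smooth_max]. *)
pose k1 := eps / 4; have k10 : 0 < k1 by rewrite divr_gt0.
have [p [p1 p2 p3 p4]] := minorant_pieces A g L k1 Asm gc gL L0 k10.
(* [K] makes [dl], [dl / k1] and [L * (dl / k1)] each at most [eta / 4]. *)
pose K := (1 + L) * (1 + k1^-1).
have K0 : 0 < K by rewrite mulr_gt0 ?ltr_wpDr// invr_ge0 ltW.
pose dl := eta / (4 * K).
have dl0 : 0 < dl by rewrite divr_gt0// mulr_gt0.
have [dla dlb dlc] : [/\ 4 * dl <= eta, 4 * (dl / k1) <= eta &
                         4 * (L * (dl / k1)) <= eta].
  have a1 : 0 <= dl / k1 by rewrite divr_ge0// ltW.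
  have a2 : 0 <= L * dl by rewrite mulr_ge0// ltW.
  have a3 : 0 <= L * (dl / k1) by rewrite mulr_ge0.
  have a4 : eta = 4 * dl + 4 * (L * dl) + 4 * (dl / k1) + 4 * (L * (dl / k1)).
    by rewrite /dl /K; field; rewrite ?gt_eqF//; rewrite ltr_wpDr.
  by split; lra.
(* Decreasing shifts: near a point where piece [k] attains [g], all pieces of larger index fall
   below it. *)
pose dk k := dl / 2 ^+ k.
have dk0 k : 0 < dk k by rewrite divr_gt0// exprn_gt0.
have dkS k j : (k < j)%N -> dk j <= dk k / 2.
  move=> kj; rewrite /dk -mulrA -invfM ler_pM2l// lef_pV2 ?posrE ?mulr_gt0 ?exprn_gt0//.
  by rewrite -exprSr ler_weXn2l// ler1n.
have dkdl k : dk k <= dl.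
  by rewrite /dk ler_pdivrMr ?exprn_gt0// ler_peMr ?(ltW dl0)// exprn_ege1// ler1n.
pose q k z := p k z + dk k.
have qub k z : q k z <= g z + dl by rewrite lerD.
have q3 k l s x y : linear_form l -> lip s (fun z => g z - l z) ->
    q k x - q k y <= l (x - y) + s * `|x - y|.
  by move=> ll gl; have := p3 k l s x y ll gl; rewrite /q; lra.
have lin0 : linear_form (fun _ : V => 0 : R) by move=> a u v; rewrite mulr0 addr0.
have gL0 : lip L (fun z => g z - 0) by move=> x y; rewrite !subr0.
pose S z := range (q ^~ z).
have Sn z : S z !=set0 by exists (q 0%N z), 0%N.
have Sb z s : S z s -> s <= g z + dl by case=> k _ <-.
pose gt z := sup (S z).
have gt1 k z : q k z <= gt z.
  by apply: (sup_approx _ _ (Sn z) (Sb z)).1; exists k.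
have gtub z b : (forall k, q k z <= b) -> gt z <= b.
  by move=> h; apply: ge_sup => // _ [k _ <-].
have gt2 z : gt z <= g z + dl by exact: gtub.
have gt3 z : g z <= gt z.
  have [k hk] := p2 z; apply: le_trans (gt1 k z).
  by rewrite /q hk lerDl ltW.
have gt4 l s x y : linear_form l -> lip s (fun z => g z - l z) ->
    gt x - gt y <= l (x - y) + s * `|x - y|.
  move=> ll gl; rewrite lerBlDl; apply: gtub => k.
  by have := q3 k l s x y ll gl; have := gt1 k y; lra.
have gtL : lip L gt by move=> x y; have := gt4 _ _ x y lin0 gL0; rewrite add0r.
have k1D (x y : V) : k1 * `|x + y| <= k1 * `|x| + k1 * `|y|.
  by rewrite -mulrDr ler_pM2l// ler_normD.
have k1N (x : V) : k1 * `|- x| = k1 * `|x| by rewrite normrN.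
have [|w1 [Aw1 h1 h1min]] := ekeland A (fun z => k1 * `|z|) gt k1 k1 L (g wb) wb
  Vc Ac k10 k1D k1N (fun=> lexx _) (fun=> lexx _) gtL _ Awb.
  by move=> w Aw; apply: le_trans (gt3 w); exact: gmin.
have dw1 : `|w1 - wb| <= dl / k1.
  rewrite ler_pdivlMr// mulrC; have := gt2 wb; have := gt3 w1; have := gmin _ Aw1; lra.
have [k hk] := p2 w1.
(* Within [rho] of [w1] the variations of [g] and of piece [k], at most [L * rho] each, do not use
   up the gap [dk k / 2] between consecutive shifts. *)
pose rho := dk k / (4 * (L + 1)).
have L1 : 0 < L + 1 by lra.
have rho0 : 0 < rho by rewrite divr_gt0// mulr_gt0.
have rhoE : dk k = 4 * (L * rho) + 4 * rho by rewrite /rho; field; rewrite gt_eqF.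
have tail j z : (k < j)%N -> `|z - w1| <= rho -> q j z <= q k z.
  move=> kj zr; have := ler_wpM2l L0 zr; have := dkS _ _ kj.
  have := q3 k _ _ w1 z lin0 gL0; have := gL z w1; have := p1 j z.
  by rewrite distrC /q hk; lra.
have kL0 : 0 < 3 * L + k1 by lra.
(* A smoothing error this small puts [w2] so close to [w1], relative to [rho], that the change of
   base point is affordable in the last clause. *)
pose tau2 := k1 * k1 * rho / (2 * (3 * L + k1)).
have tau20 : 0 < tau2.
  apply: divr_gt0; last by apply: mulr_gt0.
  by apply: mulr_gt0 => //; apply: mulr_gt0.
pose tau := Num.min (dl / 2) tau2.
have tau0 : 0 < tau by rewrite lt_min tau20 divr_gt0.
have taua : tau <= dl / 2 by rewrite ge_min lexx.
have taub : tau * (2 * (3 * L + k1)) <= k1 * (k1 * rho).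
  rewrite -ler_pdivlMr ?mulr_gt0// mulrA -/tau2.
  by rewrite ge_min lexx orbT.
have [Sm [B [B0 [s1 s2 s3 s4]]]] := smooth_max k tau tau0.
pose G z := Sm (fun i => q i z).
have G1 z : `|z - w1| <= rho -> gt z <= G z.
  move=> zr; apply: gtub => j; have [jk|kj] := leqP j k.
    by have := s1 (fun i => q i z) (Ordinal (jk : (j < k.+1)%N)).
  apply: le_trans (tail _ _ kj zr) _.
  exact: (s1 (fun i : 'I_k.+1 => q i z) ord_max).
have G2 z : G z <= gt z + tau by apply: s2 => i; exact: gt1.
have G3 l s x y : linear_form l -> lip s (fun z => g z - l z) ->
    G x - G y <= l (x - y) + s * `|x - y|.
  move=> ll gl; rewrite lerBlDl; apply: s3 => i.
  by have := q3 i l s x y ll gl; lra.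
have GL : lip L G by move=> x y; have := G3 _ _ x y lin0 gL0; rewrite add0r.
pose A2 := A `&` [set z | `|z - w1| <= rho].
have A2c : seq_closed A2.
  move=> z hz; split.
    by apply: Ac => e /hz[w [Aw _] h]; exists w.
  apply: le_of_approx => e /hz[w [_ /= wr] h].
  have := ler_normD (z - w) (w - w1); rewrite addrA subrK [`|z - w|]distrC; lra.
(* Penalty and second perturbation together have slope [2 k1], against the slope [k1] left by the
   first minimality; hence [k1 * |w2 - w1| <= tau]. *)
pose h z := G z + k1 * `|z - w1|.
have hL : lip (L + k1) h.
  move=> x y; have := GL x y; have := lip_norm k1 w1 (ltW k10) x y.
  by rewrite /h mulrDl; lra.
have hb w : A2 w -> g wb <= h w.
  move=> [Aw wr]; have := gmin _ Aw; have := gt3 w; have := G1 _ wr.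
  by have : 0 <= k1 * `|w - w1| by [rewrite mulr_ge0// ltW]; rewrite /h; lra.
have A2w1 : A2 w1 by split=> //=; rewrite subrr normr0 ltW.
have [w2 [[Aw2 w2r] h2 h2min]] := ekeland A2 (fun z => k1 * `|z|) h k1 k1 (L + k1)
  (g wb) w1 Vc A2c k10 k1D k1N (fun=> lexx _) (fun=> lexx _) hL hb A2w1.
have h2r : k1 * `|w2 - w1| <= tau.
  have := h1min _ Aw2; have := G1 _ w2r; have := G2 w1; move: h2.
  rewrite /h subrr normr0 mulr0; lra.
have r1 : 2 * (3 * L + k1) * `|w2 - w1| <= k1 * rho.
  rewrite -(ler_pM2l k10); apply: le_trans taub.
  rewrite mulrCA [leRHS]mulrC ler_pM2l// mulr_gt0//.
have Lr : 0 <= L * `|w2 - w1| by rewrite mulr_ge0.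
have r2 : 2 * `|w2 - w1| <= rho.
  rewrite -(ler_pM2l k10); apply: le_trans r1; rewrite mulrDr !mulrDl.
  by move: Lr; clear; lra.
have Gmin z : A z -> `|z - w1| <= rho -> G w2 <= G z + 2 * (k1 * `|z - w2|).
  move=> Az zr; have := h2min z (conj Az zr).
  by have := lip_norm k1 w1 (ltW k10) z w2; rewrite /h; clear; lra.
have [lam [lam0 lam1 lamS lamQ]] := s4 (fun i => q i w2).
(* Each piece is represented by one minorant, nearly active at [w2], whose slope gives its
   increments on [A] up to [k1]. *)
have /choice[fb Hfb] : forall i : 'I_k.+1, exists fb : (V -> R) * R,
    [/\ dual_le L fb.1, forall x, fb.1 x - fb.2 <= g x,
        p i w2 - tau <= fb.1 w2 - fb.2 & forall x y, A x -> A y ->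
          p i x - p i y <= fb.1 (x - y) + k1 * `|x - y| ].
  by move=> i; have [f [b ?]] := p4 i w2 tau tau0; exists (f, b).
pose s x := \sum_i lam i * (fb i).1 x.
have sl : linear_form s.
  by apply: linear_form_sum => i; have [[]] := Hfb i.
have sL x : s x <= L * `|x|.
  rewrite -[leRHS]add0r.
  have -> : 0 + L * `|x| = \sum_i lam i * (0 + L * `|x|).
    by rewrite convex_combDc// big1// => i _; rewrite mulr0.
  by apply: convex_comb_le => // i; rewrite add0r; have [[_ +] _ _ _] := Hfb i; apply.
(* [D1] keeps [z] within [rho] of [w1], [D2] meets the condition of [smooth_max], and [D3] makes its
   remainder at most [k1 * |z - w2|]. *)
pose D1 := rho / 2.
pose D2 := (B * (L + 1))^-1.
pose D3 := k1 / (B * (L ^+ 2 + 1)).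
have BL2 : 0 < B * (L ^+ 2 + 1) by rewrite mulr_gt0// ltr_wpDl// sqr_ge0.
pose d := Num.min D1 (Num.min D2 D3).
exists w2, (fun x => - s x), d; split.
  split=> //.
  - have := ler_normD (w2 - w1) (w1 - wb); rewrite addrA subrK.
    have : `|w2 - w1| <= dl / k1 / 2.
      rewrite mulrAC ler_pdivlMr// mulrC; exact: le_trans h2r taua.
    by move: dw1 dlb eta0; clear; lra.
  - split=> [a u v|x]; first by rewrite sl; ring.
    by have := sL (- x); rewrite (linear_formN s x sl) normrN.
  - rewrite !lt_min; apply/and3P; split; first exact: divr_gt0.
    + by rewrite invr_gt0; apply: mulr_gt0.
    + exact: divr_gt0.
split.
- move=> z Az; rewrite !le_min => /and3P[zD1 zD2 zD3].
  have zr : `|z - w1| <= rho.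
    have := ler_normD (z - w2) (w2 - w1); rewrite addrA subrK.
    by move: zD1 r2; rewrite /D1; clear; lra.
  have qd (i : 'I_k.+1) : `|q i z - q i w2| <= L * `|z - w2|.
    rewrite ler_norml; have := q3 i _ _ z w2 lin0 gL0.
    have := q3 i _ _ w2 z lin0 gL0; rewrite [`|w2 - z|]distrC.
    by move=> a1 a2; apply/andP; split; move: a1 a2; clear; lra.
  have Bd : B * (L * `|z - w2|) <= 1.
    have := zD2; rewrite /D2 -div1r ler_pdivlMr ?mulr_gt0//.
    have : 0 <= `|z - w2| * B by rewrite mulr_ge0// ltW.
    by rewrite mulrDr mulr1 mulrDr; clear; lra.
  have := lamQ _ _ qd Bd.
  have Bd2 : B * (L * `|z - w2|) ^+ 2 <= k1 * `|z - w2|.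
    have := zD3; rewrite /D3 ler_pdivlMr// => e1.
    have := ler_wpM2r (normr_ge0 (z - w2)) e1.
    have : 0 <= B * `|z - w2| ^+ 2 by rewrite mulr_ge0 ?sqr_ge0// ltW.
    by rewrite exprMn; clear; lra.
  have cc : \sum_i lam i * (q i z - q i w2) <= s (z - w2) + k1 * `|z - w2|.
    rewrite -convex_combDc//; apply: convex_comb_le => // i.
    by have [_ _ _ /(_ z w2 Az Aw2)] := Hfb i; rewrite /q; clear; lra.
  have := Gmin z Az zr; rewrite -/(G z) -/(G w2).
  have -> : eps * `|z - w2| = 4 * (k1 * `|z - w2|) by rewrite /k1; field.
  by move: Bd2 cc; clear; lra.
- move=> hh; rewrite opprK.
  (* The convex combination of the minorants is below [g] and at least [G w2 - 2 tau - dl] at [w2],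
     so its slope is an approximate subgradient of [g] at [wb]. *)
  have c1 : \sum_i lam i * ((fb i).1 (wb + hh) - (fb i).2) <= g (wb + hh).
    rewrite -[leRHS]add0r.
    have -> : 0 + g (wb + hh) = \sum_i lam i * (0 + g (wb + hh)).
      by rewrite convex_combDc// big1// => i _; rewrite mulr0.
    by apply: convex_comb_le => // i; rewrite add0r; have [_ + _ _] := Hfb i; apply.
  have c2 : G w2 - 2 * tau - dl <= \sum_i lam i * ((fb i).1 w2 - (fb i).2).
    apply: (@le_trans _ _ (\sum_i lam i * (q i w2 + (- tau - dl)))); last first.
      apply: convex_comb_le => // i; have [_ _ + _] := Hfb i.
      by have := dkdl i; rewrite /q; clear; lra.
    rewrite convex_combDc//; move: lamS; rewrite -/(G w2); clear; lra.
  have c3 : s (wb + hh - w2) = \sum_i lam i * ((fb i).1 (wb + hh) - (fb i).2) -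
      \sum_i lam i * ((fb i).1 w2 - (fb i).2).
    rewrite /s -sumrB; apply: eq_bigr => i _.
    by have [[fl _] _ _ _] := Hfb i; rewrite (linear_formB _ _ _ fl); ring.
  have c4 := sL (w2 - wb).
  have c5 : L * `|w2 - wb| <= L * (3 / 2 * (dl / k1)).
    apply: ler_wpM2l => //.
    have := ler_normD (w2 - w1) (w1 - wb); rewrite addrA subrK.
    have : `|w2 - w1| <= dl / k1 / 2.
      rewrite mulrAC ler_pdivlMr// mulrC; exact: le_trans h2r taua.
    by move: dw1; clear; lra.
  have c6 : s hh = s (wb + hh - w2) + s (w2 - wb).
    by rewrite -(linear_formD s _ _ sl) addrA subrK addrC addKr.
  have := G1 _ w2r; have := gt3 w2; have := gmin _ Aw2.
  rewrite [L * (3 / 2 * _)]mulrCA in c5.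
  by move: c1 c2 c3 c4 c5 c6 taua dla dlc eta0; clear; lra.
move=> l sg ll sg0 sgL gl z Az.
have e1 : (sg + eps) * `|z - w2| = sg * `|z - w2| + 4 * (k1 * `|z - w2|).
  by rewrite /k1; field.
have k1z : 0 <= k1 * `|z - w2| by rewrite mulr_ge0// ltW.
(* Near [w1] the second minimality applies. Farther away the first one does, and there
   [|z - w2| >= rho / 2] absorbs the passage from [w1] to [w2]. *)
have [zr|zr] := leP `|z - w1| rho.
  by have := Gmin z Az zr; have := G3 l sg z w2 ll gl; move: e1 k1z; clear; lra.
have b1 := h1min z Az; have b2 := gt4 l sg z w1 ll gl.
have b3 : l (z - w2) = l (z - w1) + l (w1 - w2).
  by rewrite -(linear_formD l _ _ ll) addrA subrK.
have b4 : - l (w1 - w2) <= (L + sg) * `|w2 - w1|.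
  have := gL w2 w1; have := gl w1 w2; rewrite (linear_formB l _ _ ll) distrC.
  by rewrite mulrDl; clear; lra.
have b5 : `|z - w1| <= `|z - w2| + `|w2 - w1|.
  by have := ler_normD (z - w2) (w2 - w1); rewrite addrA subrK.
have b6 := ler_wpM2l sg0 b5.
have b7 := ler_wpM2l (ltW k10) b5.
have b8 := ler_wpM2r (normr_ge0 (w2 - w1)) sgL.
have b9 : k1 * rho <= 2 * (k1 * `|z - w2|).
  by rewrite [leRHS]mulrCA ler_pM2l//; move: zr b5 r2; clear; lra.
rewrite e1 b3; rewrite mulrDl in b4; rewrite mulrDr in b6; rewrite mulrDr in b7.
by move: r1 b1 b2 b4 b6 b7 b8 b9 Lr k1z; rewrite mulrDr mulrDl; clear; lra.
Qed.

End FuzzyStep.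

(** * Exact normals on small sets, by iteration *)

Section FuzzyExact.
Context {R : realType} {V : normedModType R}.

Lemma convex_norm_linear (k : R) (w : V) (l : V -> R) : 0 <= k -> linear_form l ->
  convex_fun_on setT (fun z => k * `|z - w| - l (z - w)).
Proof.
move=> k0 ll x y t _ _ /andP[t0 t1].
have -> : t *: x + (1 - t) *: y - w = t *: (x - w) + (1 - t) *: (y - w).
  by rewrite !scalerBr addrACA -opprD -scalerDl [t + _]addrC subrK scale1r.
rewrite (linear_formD l _ _ ll) !(linear_formZ l _ _ ll).
have t1' : 0 <= 1 - t by rewrite subr_ge0.
have := ler_normD (t *: (x - w)) ((1 - t) *: (y - w)).
rewrite !normrZ (ger0_norm t0) (ger0_norm t1') => /(ler_wpM2l k0).
by clear; lra.
Qed.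

Lemma seq_closed_ball (A : set V) w d : seq_closed A ->
  seq_closed (A `&` [set z | `|z - w| <= d]).
Proof.
move=> Ac z hz; split.
  by apply: Ac => e /hz[u [Au _] h]; exists u.
apply: le_of_approx => e /hz[u [_ /= ur] h].
have := ler_normD (z - u) (u - w); rewrite addrA subrK [`|z - u|]distrC; lra.
Qed.

(** As [f] is a [k]-normal at [w], the function [k |z - w| - f (z - w)] is minimal at [w] on a ball.
    [fuzzy_step] applied to it gives an [eps]-normal within [k] of [f], and its last clause controls
    [f] around the new point [w']. *)
Lemma fuzzy_refine (A : set V) (M k d eta eps : R) (w : V) (f : V -> R) :
  seq_complete V -> seq_closed A -> dual_small_on A ->
  0 <= M -> 0 < k -> 0 < d -> 0 < eta -> 0 < eps -> A w -> dual_le M f ->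
  (forall z, A z -> `|z - w| <= d -> f (z - w) <= k * `|z - w|) ->
  exists w' f' d', [/\ A w', `|w' - w| <= eta, dual_le (M + k) f',
     0 < d' <= d / 2 & forall h, `|f' h - f h| <= k * `|h| ] /\
  (forall z, A z -> `|z - w'| <= d' -> f' (z - w') <= eps * `|z - w'|) /\
  (forall z, A z -> `|z - w| <= d -> f (z - w') <= (k + eps) * `|z - w'|).
Proof.
move=> Vc Ac Asm M0 k0 d0 eta0 eps0 Aw fM fn.
pose g z := k * `|z - w| - f (z - w).
have gc : convex_fun_on setT g.
  by apply: convex_norm_linear; [exact: ltW|exact: fM.1].
have gf : lip k (fun z => g z - - f z).
  move=> x y; have := lip_norm k w (ltW k0) x y.
  by rewrite /g !(linear_formB f _ _ fM.1); clear; lra.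
have gL : lip (M + k) g.
  by move=> x y; have := gf x y; have := dual_le_lip _ _ fM y x;
    rewrite [`|y - x|]distrC mulrDl; clear; lra.
pose A2 := A `&` [set z | `|z - w| <= d].
have A2w : A2 w by split=> //=; rewrite subrr normr0 ltW.
have g0 : g w = 0 by rewrite /g subrr normr0 mulr0 (linear_form0 f fM.1) subrr.
have gm z : A2 z -> g w <= g z.
  by move=> [Az zd]; rewrite g0 /g subr_ge0; exact: fn.
pose eta' := Num.min eta (d / 4).
have eta'0 : 0 < eta' by rewrite lt_min eta0 divr_gt0.
have [w' [f' [d' [[[Aw' w'd] w'w fM' d'0] [h1 h2 h3]]]]] :=
  fuzzy_step A2 g (M + k) eps eta' w Vc (seq_closed_ball _ _ _ Ac)
    (dual_small_onS _ _ (@subIsetl _ _ _) Asm) gc gL (addr_ge0 M0 (ltW k0))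
    A2w gm eps0 eta'0.
move: w'w; rewrite le_min => /andP[w'w1 w'w2].
exists w', f', (Num.min d' (d / 2)); split; last split.
- split=> //; first by rewrite lt_min d'0 divr_gt0//= ge_min lexx orbT.
  have key h : f h - f' h <= k * `|h|.
    apply: (@le_of_scaling _ _ _ eta') => t t0.
    have := h2 (t *: h); rewrite g0 /g [w + _]addrC addrK normrZ (gtr0_norm t0).
    rewrite (linear_formZ f _ _ fM.1) (linear_formZ f' _ _ fM'.1).
    by clear; lra.
  move=> h; have k1 := key h; have := key (- h).
  rewrite (linear_formN f _ fM.1) (linear_formN f' _ fM'.1) normrN => k2.
  by rewrite ler_norml; apply/andP; split; clear -k1 k2; lra.
- move=> z Az; rewrite le_min => /andP[z1 z2]; apply: h1 => //; split=> //=.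
  have := ler_normD (z - w') (w' - w); rewrite addrA subrK.
  by move: z2 w'w2 d0; clear; lra.
move=> z Az zd.
have fl : linear_form (fun x => - f x) by move=> a u v; rewrite fM.1; ring.
have := h3 (fun x => - f x) k fl (ltW k0).
by rewrite lerDr => /(_ M0 gf z (conj Az zd)); rewrite opprK.
Qed.

(** The tolerances [e n] are halved at each refinement, so points and functionals converge.
    Exactness at the limit is checked, at distance [t], with the last stage whose half radius still
    reaches [t]. *)
Lemma fuzzy_exact (A : set V) (g : V -> R) (L eta : R) (wb : V) :
  seq_complete V -> seq_closed A -> dual_small_on A ->
  convex_fun_on setT g -> lip L g -> 0 <= L ->
  A wb -> (forall z, A z -> g wb <= g z) -> 0 < eta ->
  exists w f, [/\ A w, `|w - wb| <= eta, linear_form f,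
    forall h, - f h <= g (wb + h) - g wb + eta * (1 + `|h|) &
    forall eps, 0 < eps -> exists2 d, 0 < d &
      forall z, A z -> `|z - w| <= d -> f (z - w) <= eps * `|z - w| ].
Proof.
move=> Vc Ac Asm gc gL L0 Awb gmin eta0.
pose e n := eta / 4 / 2 ^+ n.
have e0 n : 0 < e n by rewrite !divr_gt0// exprn_gt0.
have eS n : e n.+1 = e n / 2 by rewrite /e exprSr invfM mulrA.
have ele n : e n <= eta / 4.
  elim: n => [|n IH]; first by rewrite /e expr0 divr1.
  by rewrite eS; move: (e0 n) IH; clear; lra.
pose B := L + eta + 1; have B0 : 0 < B by rewrite /B; lra.
(* [L] plus the sum of the first [n] tolerances, in closed form. *)
pose Lf n := L + eta / 2 - 2 * e n.
have LfS n : Lf n.+1 = Lf n + e n by rewrite /Lf eS; field.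
have Lf0 n : 0 <= Lf n by rewrite /Lf; move: (ele n) L0 eta0; clear; lra.
have LfB n : Lf n <= B by rewrite /Lf /B; move: (e0 n) eta0; clear; lra.
pose st := (V * (V -> R) * R)%type.
pose Inv n (s : st) := [/\ A s.1.1, 0 < s.2, dual_le (Lf n) s.1.2 &
  forall z, A z -> `|z - s.1.1| <= s.2 -> s.1.2 (z - s.1.1) <= e n * `|z - s.1.1| ].
(* The displacement from stage [n] on is at most twice this, so [B] times it is at most
   [e n * d n / 4]. *)
pose et n (d : R) := e n / (8 * B) * d.
pose Rel n (s s' : st) := [/\ `|s'.1.1 - s.1.1| <= et n s.2, 0 < s'.2 <= s.2 / 2,
  forall h, `|s'.1.2 h - s.1.2 h| <= e n * `|h| &
  forall z, A z -> `|z - s.1.1| <= s.2 ->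
    s.1.2 (z - s'.1.1) <= 2 * (e n * `|z - s'.1.1|) ].
have et0 n d : 0 < d -> 0 < et n d.
  by move=> d0; rewrite mulr_gt0// divr_gt0// mulr_gt0.
have /choice[step Hstep] : forall ns : nat * st, exists s',
    Inv ns.1 ns.2 -> Inv ns.1.+1 s' /\ Rel ns.1 ns.2 s'.
  move=> [n [[w f] d]]; have [h|h] := pselect (Inv n (w, f, d)); last first.
    by exists (w, f, d) => /h.
  have [/= Aw d0 fM fn] := h.
  have [w' [f' [d' [[Aw' w'w fM' dd' ff'] [fn' fd]]]]] := fuzzy_refine A (Lf n)
    (e n) d (et n d) (e n.+1) w f Vc Ac Asm (Lf0 n) (e0 n) d0 (et0 _ _ d0)
    (e0 n.+1) Aw fM fn.
  have /andP[d'0 d'd] := dd'.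
  exists (w', f', d') => _; split; split=> //=; first by rewrite LfS.
  move=> z Az zd; apply: le_trans (fd z Az zd) _; rewrite mulrA ler_wpM2r//.
  by rewrite eS; move: (e0 n); clear; lra.
have eta2 : 0 < eta / 4 by rewrite divr_gt0.
have [w0 [f0 [d0 [[Aw0 w0b f0L d00] [h1 h2 _]]]]] := fuzzy_step A g L (eta / 4)
  (eta / 4) wb Vc Ac Asm gc gL L0 Awb gmin eta2 eta2.
pose d0' := Num.min d0 1.
have d0'0 : 0 < d0' by rewrite lt_min d00 ltr01.
pose u := fix u n := if n is n'.+1 then step (n', u n') else (w0, f0, d0').
have Iu n : Inv n (u n).
  elim: n => [|n IH]; last by have [] := Hstep (n, u n) IH.
  split=> //=.
    by rewrite /Lf /e expr0 divr1 [X in dual_le X _](_ : _ = L)//; field.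
  move=> z Az; rewrite le_min => /andP[zd _]; rewrite /e expr0 divr1; exact: h1.
have Ru n : Rel n (u n) (u n.+1) by have [] := Hstep (n, u n) (Iu n).
pose w n := (u n).1.1; pose f n := (u n).1.2; pose d n := (u n).2.
pose eta_ n := et n (d n).
have dS n : 0 < d n by have [] := Iu n.
have dh n : d n.+1 <= d n / 2 by have [_ /andP[]] := Ru n.
have etaS n : 2 * eta_ n.+1 <= eta_ n.
  have c0 : 0 < e n / (8 * B) by rewrite divr_gt0// mulr_gt0.
  have := ler_wpM2l (ltW c0) (dh n); have := mulr_gt0 c0 (dS n).
  rewrite /eta_ /et eS [e n / 2 / (8 * B)]mulrAC.
  by clear; lra.
have eta0n n : 0 < eta_ n by exact: et0.
have wn n k : `|w (n + k)%N - w n| <= 2 * eta_ n - 2 * eta_ (n + k)%N.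
  elim: k => [|k IH]; first by rewrite addn0 !subrr normr0.
  have [h _ _ _] := Ru (n + k)%N.
  have := ler_normD (w (n + k).+1 - w (n + k)%N) (w (n + k)%N - w n).
  rewrite addrA subrK addnS; move: h (etaS (n + k)%N) IH.
  by rewrite -/(w _) -/(w _) -/(d _) -/(eta_ _); clear; lra.
have wnm n m : (n <= m)%N -> `|w m - w n| <= 2 * eta_ n.
  move=> nm; have := wn n (m - n)%N; rewrite subnKC//.
  by move: (eta0n m); clear; lra.
have eta_d n : 8 * eta_ n <= d n.
  rewrite /eta_ /et mulrA ler_piMl ?(ltW (dS n))//.
  rewrite mulrA ler_pdivrMr ?mulr_gt0// mul1r ler_pM2l//.
  by move: (ele n) L0 eta0; rewrite /B; clear; lra.
have pow n : e n <= eta / n.+1%:R.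
  rewrite /e -[eta / 4 / _]mulrA -invfM ler_pM2l// lef_pV2 ?posrE ?mulr_gt0 ?exprn_gt0//.
  elim: (n) => [|m IH]; first by rewrite expr0; clear; lra.
  by rewrite exprSr -[m.+2]addn1 natrD; move: IH (ler1n R m.+1); rewrite ltnS leq0n mulrA; clear; lra.
have small t : 0 < t -> exists n, e n <= t.
  move=> t0; exists (Num.truncn (eta / t)); apply: le_trans (pow _) _.
  rewrite ler_pdivrMr ?ltr0n// mulrC -ler_pdivrMr//.
  by apply: ltW; exact: truncnS_gt.
have dle n : d n <= e n * (4 / eta).
  elim: n => [|n IH].
    have -> : e 0%N * (4 / eta) = 1 by rewrite /e expr0 divr1; field; rewrite gt_eqF.
    by rewrite /d/= ge_min lexx orbT.
  by have := dh n; rewrite eS mulrAC; move: IH; clear; lra.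
have [wl Hwl] : exists l, forall t, 0 < t ->
    exists N, forall n, (N <= n)%N -> `|w n - l| <= t.
  apply: Vc => t t0.
  have [N hN] := small (eta * t) (mulr_gt0 eta0 t0).
  exists N => n Nn; apply: le_trans (wnm _ _ Nn) _.
  have := eta_d N; have := dle N.
  have : e N * (4 / eta) <= 4 * t.
    rewrite [leRHS](_ : _ = eta * t * (4 / eta)); last by field; rewrite gt_eqF.
    by rewrite ler_wpM2r// divr_ge0// ltW.
  by clear; lra.
have wlw n : `|wl - w n| <= 2 * eta_ n.
  apply: le_of_approx => t /Hwl[N hN].
  have := hN (maxn N n) (leq_maxl _ _); have := wnm n (maxn N n) (leq_maxr _ _).
  have := ler_normD (wl - w (maxn N n)) (w (maxn N n) - w n).
  by rewrite addrA subrK [`|wl - w (maxn _ _)|]distrC; clear; lra.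
have fS n h : `|f n.+1 h - f n h| <= e n * `|h| by have [_ _ + _] := Ru n; apply.
have fnk n k h : `|f (n + k)%N h - f n h| <= 2 * (e n * `|h|) - 2 * (e (n + k)%N * `|h|).
  elim: k => [|k IH]; first by rewrite addn0 !subrr normr0.
  have := ler_normD (f (n + k).+1 h - f (n + k)%N h) (f (n + k)%N h - f n h).
  rewrite addrA subrK addnS eS; move: (fS (n + k)%N h) IH.
  by clear; lra.
have fnm n m h : (n <= m)%N -> `|f m h - f n h| <= 2 * (e n * `|h|).
  move=> nm; have := fnk n (m - n)%N h; rewrite subnKC//.
  have : 0 <= e m * `|h| by rewrite mulr_ge0// ltW.
  by clear; lra.
have /choice[fl Hfl] : forall h, exists y, forall t, 0 < t ->
    exists N, forall n, (N <= n)%N -> `|f n h - y| <= t.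
  move=> h; apply: (complete_seq_complete R^o (fun n => f n h)) => t t0.
  have h10 : 0 < 2 * (`|h| + 1) by rewrite mulr_gt0// ltr_wpDl.
  have [N hN] := small (t / (2 * (`|h| + 1))) (divr_gt0 t0 h10).
  exists N => n Nn; apply: le_trans (fnm _ _ h Nn) _.
  move: hN; rewrite ler_pdivlMr//; move: (e0 N); clear; lra.
have ffl n h : `|fl h - f n h| <= 2 * (e n * `|h|).
  apply: le_of_approx => t /(Hfl h)[N hN].
  have := hN (maxn N n) (leq_maxl _ _); have := fnm n (maxn N n) h (leq_maxr _ _).
  have := ler_normD (fl h - f (maxn N n) h) (f (maxn N n) h - f n h).
  by rewrite addrA subrK [`|fl h - f (maxn _ _) h|]distrC; clear; lra.
have fll : linear_form fl.
  move=> a x y; apply/eqP; rewrite -subr_eq0 -normr_le0; apply: le_of_approx => t t0.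
  rewrite add0r; pose C := `|a *: x + y| + `|a| * `|x| + `|y|.
  have C0 : 0 <= C by rewrite !addr_ge0// mulr_ge0.
  have C10 : 0 < 2 * (C + 1) by rewrite mulr_gt0// ltr_wpDl.
  have [n hn] := small (t / (2 * (C + 1))) (divr_gt0 t0 C10).
  have [_ _ [fnl _] _] := Iu n.
  have -> : fl (a *: x + y) - (a * fl x + fl y) = (fl (a *: x + y) - f n (a *: x + y))
      - a * (fl x - f n x) - (fl y - f n y) by rewrite /f fnl; ring.
  apply: le_trans (ler_normB _ _) _.
  have := ler_normB (fl (a *: x + y) - f n (a *: x + y)) (a * (fl x - f n x)).
  rewrite normrM; have := ler_wpM2l (normr_ge0 a) (ffl n x).
  have := ffl n y; have := ffl n (a *: x + y).
  move: hn; rewrite ler_pdivlMr// /C; move: (e0 n); clear; lra.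
exists wl, fl; split=> //.
- by apply: Ac => t /Hwl[N hN]; exists (w N); [have [] := Iu N|exact: hN].
- have := ler_normD (wl - w 0%N) (w 0%N - wb); rewrite addrA subrK.
  have := wlw 0%N; have : 8 * eta_ 0%N <= eta.
    rewrite /eta_ /et mulrA; apply: le_trans (_ : eta * d 0%N <= _).
      rewrite ler_pM2r// mulrA ler_pdivrMr ?mulr_gt0//.
      have : 0 <= eta * L by rewrite mulr_ge0// ltW.
      have : 0 < eta * eta by rewrite mulr_gt0.
      by move: (ele 0%N) eta0; rewrite /B; clear; lra.
    by rewrite ler_piMr ?(ltW eta0)// /d/= ge_min lexx orbT.
  by move: w0b eta0; rewrite /w/=; clear; lra.
- move=> h; have := h2 h; have := ffl 0%N h; rewrite ler_norml => /andP[+ _].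
  rewrite /f/= /e expr0 divr1; have : 0 <= eta * `|h| by rewrite mulr_ge0// ltW.
  by move: eta0; clear; lra.
move=> eps eps0.
have [n hn] := small (eps / 5) (divr_gt0 eps0 (ltr0n _ 5)).
exists (d n / 2) => [|z Az]; first by rewrite divr_gt0.
set t := `|z - wl| => zt.
have [z0|z0] := eqVneq z wl.
  rewrite z0 subrr (linear_form0 fl fll).
  exact: mulr_ge0 (ltW eps0) (normr_ge0 _).
have t0 : 0 < t by rewrite normr_gt0 subr_eq0.
(* At stage [m] the point [z] is still in the ball around [w m], while [wl] is within
   [e m * t / (4 B)] of [w m.+1] because [d m.+1 < 2 t]. *)
have [m nm [tm1 tm2]] : exists2 m, (n <= m)%N & t <= d m / 2 /\ d m.+1 / 2 < t.
  have ex : exists k, d k / 2 < t.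
    have [k hk] := small (t * (eta / 4)) (mulr_gt0 t0 eta2).
    exists k; apply: le_lt_trans (_ : t / 2 < t); last by rewrite ltr_pdivrMr//; lra.
    rewrite ler_pM2r// (le_trans (dle k))//.
    by rewrite -ler_pdivlMr ?divr_gt0// invf_div.
  (* The least [k] with [d k / 2 < t] is not [0], since [t <= d n / 2]; [m] is its predecessor. *)
  case: (ex_minnP ex) => -[|k] hk kmin.
    exfalso; move: hk; rewrite ltNge => /negP; apply; apply: le_trans zt _.
    have dn : forall m, d m <= d 0%N.
      elim=> // j IH; apply: le_trans (dh j) _; apply: le_trans IH.
      by move: (dS j); clear; lra.
    by rewrite ler_pM2r.
  exists k; last first.
    split=> //; rewrite leNgt; apply/negP => /kmin; by rewrite ltnn.
  rewrite leqNgt; apply/negP => kn.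
  have dn j : d (k.+1 + j)%N <= d k.+1.
    elim: j => [|j IH]; first by rewrite addn0.
    rewrite addnS; apply: le_trans (dh _) _; apply: le_trans IH.
    by move: (dS (k.+1 + j)%N); clear; lra.
  have := dn (n - k.+1)%N; rewrite subnKC//.
  by move: hk zt; clear; lra.
have em : e m <= eps / 5.
  apply: le_trans hn; rewrite -(subnKC nm); elim: (m - n)%N => [|j IH].
    by rewrite addn0.
  by rewrite addnS eS; move: IH (e0 (n + j)%N); clear; lra.
set r := `|wl - w m.+1|.
have rB : B * r <= e m * t / 4.
  apply: (@le_trans _ _ (B * (2 * eta_ m.+1))); first by rewrite ler_pM2l//; exact: wlw.
  have -> : B * (2 * eta_ m.+1) = e m * d m.+1 / 8.
    by rewrite /eta_ /et eS; field; rewrite gt_eqF.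
  have : e m * d m.+1 <= e m * (2 * t) by rewrite ler_pM2l//; move: tm2; clear; lra.
  by clear; lra.
have zwm : `|z - w m| <= d m.
  have := ler_normD (z - wl) (wl - w m); rewrite addrA subrK -/t.
  by have := wlw m; have := eta_d m; have := dS m; move: tm1; clear; lra.
(* The errors are [2 e m (t + r)] from the change of stage, [B r] from the shift to [wl] and
   [2 e m t] from the limit of the functionals; together at most [5 e m t]. *)
have [_ _ _ /(_ z Az zwm) k1] := Ru m.
have [_ _ fmL _] := Iu m.
have k2 : `|z - w m.+1| <= t + r.
  by have := ler_normD (z - wl) (wl - w m.+1); rewrite addrA subrK.
have k3 : f m (w m.+1 - wl) <= B * r.
  apply: le_trans (fmL.2 _) _; rewrite distrC ler_wpM2r//.
have k4 : f m (z - wl) = f m (z - w m.+1) + f m (w m.+1 - wl).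
  by rewrite -(linear_formD (f m) _ _ fmL.1) addrA subrK.
have k5 := ffl m (z - wl); rewrite -/t ler_norml in k5; case/andP: k5 => _ k5.
have k6 := ler_wpM2l (ltW (e0 m)) k2.
have k7 : e m * r <= B * r.
  apply: ler_wpM2r; first exact: normr_ge0.
  by apply: le_trans (ele m) _; rewrite /B; move: L0 eta0; clear; lra.
have k8 : e m * t <= eps / 5 * t by rewrite ler_pM2r.
have k9 := mulr_gt0 (e0 m) t0.
move: k1 k3 k4 k5 k6 k7 k8 k9 rB; rewrite -/(f m) -/(w m.+1) mulrDr; clear; lra.
Qed.

End FuzzyExact.

(** * Lifting normals from a countable set *)

Section Lift.
Context {R : realType} {V : normedModType R}.

(* A triple (lam, eps, u) stands for lam times the constraint
   f (u - w) <= eps * `|u - w| on the unknown functional f. *)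
Definition cost (w : V) (l : seq (R * R * V)) : R :=
  \sum_(c <- l) c.1.1 * (c.1.2 * `|c.2 - w|).
Definition vec (w : V) (l : seq (R * R * V)) : V :=
  \sum_(c <- l) c.1.1 *: (c.2 - w).
(** A common Lipschitz constant of [cost] and [vec] in the base point. *)
Definition weight (l : seq (R * R * V)) : R :=
  \sum_(c <- l) `|c.1.1| * (1 + `|c.1.2|).

Lemma weight_ge0 l : 0 <= weight l.
Proof. by apply: sumr_ge0 => c _; rewrite mulr_ge0// addr_ge0. Qed.

Lemma cost_base w b l : cost b l <= cost w l + weight l * `|b - w|.
Proof.
rewrite /cost /weight mulr_suml -big_split; apply: ler_sum => c _ /=.
have h : `|(`|c.2 - b| - `|c.2 - w|)| <= `|b - w|.
  apply: le_trans (ler_dist_dist _ _) _.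
  by rewrite opprB addrC addrA subrK distrC.
rewrite -lerBlDl -!mulrBr; apply: le_trans (ler_norm _) _; rewrite !normrM -mulrA.
apply: ler_wpM2l => //; apply: ler_pM => //.
by rewrite lerDr.
Qed.

Lemma vec_base w b l : `|vec b l - vec w l| <= weight l * `|b - w|.
Proof.
rewrite /vec /weight mulr_suml -sumrB; apply: le_trans (ler_norm_sum _ _ _) _.
apply: ler_sum => c _; rewrite -scalerBr opprB addrC addrA subrK normrZ distrC -mulrA.
apply: ler_wpM2l => //; rewrite mulrDl mul1r lerDl; exact: mulr_ge0.
Qed.

Lemma linear_form_vec_le f w l : linear_form f ->
  (forall c, c \in l -> 0 <= c.1.1 /\ f (c.2 - w) <= c.1.2 * `|c.2 - w|) ->
  f (vec w l) <= cost w l.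
Proof.
move=> fl; elim: l => [|c l IH] H; rewrite /vec /cost ?big_nil ?big_cons.
  by rewrite linear_form0.
rewrite fl lerD//; last by apply: IH => x xl; apply: H; rewrite inE xl orbT.
by have [c0 hc] := H c (mem_head _ _); rewrite ler_wpM2l.
Qed.

(* Lists with rational coefficients, a radius for each point being kept aside. *)
Fixpoint rational_list (s : seq (rat * rat * rat)) (u : nat -> V) :=
  if s is x :: t then
    (ratr x.1.1 : R, ratr x.1.2 : R, u 0%N) :: rational_list t (fun i => u i.+1)
  else [::].

Lemma weight_rational_list s u v :
  weight (rational_list s u) = weight (rational_list s v).
Proof.
elim: s u v => [//|x s IH] u v; rewrite /weight/= !big_cons; congr (_ + _).
exact: IH.
Qed.

Lemma rational_listP s u c : c \in rational_list s u -> exists2 i, (i < size s)%N &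
  c = (ratr (nth 0 s i).1.1, ratr (nth 0 s i).1.2, u i).
Proof.
elim: s u => [//|x s IH] u; rewrite /= inE => /predU1P[->|/IH[i si ->]].
  by exists 0%N.
by exists i.+1.
Qed.

(** Weights are raised slightly to rationals, the tolerances [1 / (j + 1)] are rational already, and
    rational radii keep a margin [rho] on both sides so that the base point may move by [rho]. *)
Lemma rational_approx (Om : set V) (w : V) (d : nat -> R) l (k : R) :
  (forall j, 0 < d j) -> 0 < k ->
  (forall c, c \in l -> exists j, [/\ 0 <= c.1.1, c.1.2 = j.+1%:R^-1, Om c.2 &
     `|c.2 - w| <= d j / 2]) ->
  exists s u rho, [/\ 0 < rho, forall i, (i < size s)%N -> let x := nth 0 s i in
     exists j, [/\ 0 <= (ratr x.1.1 : R), ratr x.1.2 = j.+1%:R^-1 :> R, Om (u i) &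
       `|u i - w| + rho <= ratr x.2 /\ ratr x.2 + rho <= d j],
     cost w (rational_list s u) <= cost w l + k &
     `|vec w (rational_list s u) - vec w l| <= k].
Proof.
move=> d0; elim: l k => [|c l IH] k k0 H.
  exists [::], (fun=> w), 1; split=> //; rewrite /cost /vec !big_nil.
    by rewrite add0r ltW.
  by rewrite subrr normr0 ltW.
have k2 : 0 < k / 2 by rewrite divr_gt0.
have [|s [u [rho [rho0 hs hc hv]]]] := IH _ k2.
  by move=> c' c'l; apply: H; rewrite inE c'l orbT.
have [j [c0 cj Omc cd]] := H c (mem_head _ _).
pose m := k / 2 / (`|c.2 - w| + 1).
have n0 : 0 < `|c.2 - w| + 1 by rewrite ltr_wpDl.
have m0 : 0 < m by rewrite divr_gt0.
have [q qc] := @rat_in_itvoo R c.1.1 (c.1.1 + m) (ltac:(by rewrite ltrDl)).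
have /andP[q1 q2] : c.1.1 < ratr q < c.1.1 + m by move: qc; rewrite in_itv.
(* This leaves [d j / 8] above [d j / 2] and below [d j]. *)
have dj : 5 / 8 * d j < 7 / 8 * d j by move: (d0 j); clear; lra.
have [r rd] := rat_in_itvoo dj.
have /andP[r1 r2] : 5 / 8 * d j < ratr r < 7 / 8 * d j by move: rd; rewrite in_itv.
have mn : m * `|c.2 - w| <= k / 2.
  have : m * (`|c.2 - w| + 1) = k / 2 by rewrite /m divfK// gt_eqF.
  by rewrite mulrDr mulr1; move: m0; clear; lra.
have qc1 : `|ratr q - c.1.1| <= m by rewrite ler_norml; move: q1 q2; clear; lra.
exists ((q, j.+1%:R^-1, r) :: s), (fun i => if i is i'.+1 then u i' else c.2).
exists (Num.min rho (d j / 8)); split.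
- by rewrite lt_min rho0 divr_gt0.
- case=> [_|i si] /=.
    exists j; split=> //.
    + exact: le_trans c0 (ltW q1).
    + by rewrite fmorphV/= ratr_nat.
    have : Num.min rho (d j / 8) <= d j / 8 by rewrite ge_min lexx orbT.
    by move: r1 r2 cd; clear; lra.
  have [j' [a1 a2 a3 [a4 a5]]] := hs i si; exists j'; split=> //.
  have : Num.min rho (d j / 8) <= rho by rewrite ge_min lexx.
  by move: a4 a5; clear; lra.
- rewrite /cost /= !big_cons/= fmorphV/= ratr_nat -cj -!/(cost _ _).
  have c1 : c.1.2 * `|c.2 - w| <= `|c.2 - w|.
    by rewrite ler_piMl// cj invf_le1 ?ltr0n// ler1n.
  have c10 : 0 <= c.1.2 * `|c.2 - w| by rewrite mulr_ge0// cj invr_ge0.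
  have h1 := ler_wpM2r c10 (ltW q2); have h2 := ler_wpM2l (ltW m0) c1.
  by move: h1 h2 hc mn; rewrite mulrDl; clear; lra.
rewrite /vec /= !big_cons/= -!/(vec _ _) opprD addrACA -scalerBl.
apply: le_trans (ler_normD _ _) _; rewrite normrZ.
have := ler_wpM2r (normr_ge0 (c.2 - w)) qc1.
by move: hv mn; clear; lra.
Qed.

End Lift.

(** * Normals to arbitrary closed sets *)

Section FuzzyNormal.
Context {R : realType} {V : normedModType R}.

(** Covering the differences [D i - D j] makes functionals near one centre agree on them up to
    [eps]; the bound [M] extends this to the closure. *)
Lemma dual_small_on_closure (I : countType) (D : I -> V) : dual_covered V ->
  dual_small_on [set z | forall e : R, 0 < e -> exists i, `|D i - z| <= e].
Proof.
move=> Vcov eps M eps0 M0.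
have e2 : 0 < eps / 2 by rewrite divr_gt0.
have [F HF] := Vcov (I * I)%type (fun ij => D ij.1 - D ij.2) (eps / 2) M e2 M0.
have /choice[cl Hcl] : forall f, exists k, dual_le M f -> forall ij : I * I,
   `|f (D ij.1 - D ij.2) - F k (D ij.1 - D ij.2)| <= eps / 2 * `|D ij.1 - D ij.2|.
  move=> f; have [/HF[k hk]|h] := pselect (dual_le M f); first by exists k.
  by exists 0%N => /h.
exists cl => f f' fM f'M ff' x y Dx Dy; apply: le_of_approx => e e0.
pose C := 2 * eps + 4 * M; have C0 : 0 < C by rewrite /C; lra.
have [i hi] := Dx _ (divr_gt0 e0 C0); have [j hj] := Dy _ (divr_gt0 e0 C0).
have := Hcl f fM (i, j); have := Hcl f' f'M (i, j); rewrite -ff' /=.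
set v := D i - D j; set N := F _ _; rewrite !ler_norml => /andP[a1 _] /andP[_ a2].
have vxy : `|v - (x - y)| <= 2 * (e / C).
  have -> : v - (x - y) = (D i - x) - (D j - y).
    by rewrite /v !opprB [y - x]addrC addrACA [- D j + y]addrC.
  by apply: le_trans (ler_normB _ _) _; move: hi hj; clear; lra.
have b1 := dual_le_abs _ _ (v - (x - y)) fM.
have b2 := dual_le_abs _ _ (v - (x - y)) f'M.
rewrite (linear_formB f _ _ fM.1) in b1; rewrite (linear_formB f' _ _ f'M.1) in b2.
have b3 := ler_wpM2l M0 vxy.
have b4 : `|v| <= `|x - y| + 2 * (e / C).
  by have := ler_normD (v - (x - y)) (x - y); rewrite subrK; move: vxy; clear; lra.
have b5 := ler_wpM2l (ltW eps0) b4.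
move: b1 b2; rewrite !ler_norml => /andP[b1 _] /andP[_ b2].
have eE : e = 2 * eps * (e / C) + 4 * M * (e / C).
  by rewrite -mulrDl mulrC divfK// gt_eqF.
by move: eE a1 a2 b1 b2 b3 b5; clear; lra.
Qed.

(** [fuzzy_exact] gives [f] on the closure [A] of a countable orbit in [Om]. By
    [convex_linear_minorant], a functional for all of [Om] exists if no finite combination of the
    constraints is contradictory ([claim]); a contradictory one would have a copy with points in
    [A], where [f] excludes it. *)
Theorem fuzzy_normal (Om : set V) (g : V -> R) (L eta : R) (wb : V) :
  seq_complete V -> dual_covered V -> seq_closed Om ->
  convex_fun_on setT g -> lip L g -> 0 <= L ->
  Om wb -> (forall z, Om z -> g wb <= g z) -> 0 < eta ->
  exists w f, [/\ Om w, `|w - wb| <= eta, dual_le (L + eta) f,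
    forall h, - f h <= g (wb + h) - g wb + eta * (1 + `|h|) &
    forall eps, 0 < eps -> exists2 d, 0 < d &
      forall z, Om z -> `|z - w| <= d -> f (z - w) <= eps * `|z - w| ].
Proof.
move=> Vc Vcov Oc gc gL L0 Owb gmin eta0.
pose M1 := L + eta; have M10 : 0 <= M1 by rewrite addr_ge0// ltW.
pose Gx h := g (wb + h) - g wb + eta * (1 + `|h|).
have Gx0 : Gx 0 = eta by rewrite /Gx addr0 subrr normr0 add0r addr0 mulr1.
have GxL : lip M1 Gx.
  move=> x y; have := gL (wb + x) (wb + y); have := lip_norm eta 0 (ltW eta0) x y.
  rewrite !subr0 opprD addrACA subrr add0r /Gx /M1 mulrDl.
  by clear; lra.
have Gxc x y t : 0 <= t <= 1 ->
    Gx (t *: x + (1 - t) *: y) <= t * Gx x + (1 - t) * Gx y.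
  move=> ht; have /andP[t0 t1] := ht.
  have := gc (wb + x) (wb + y) t Logic.I Logic.I ht.
  have -> : t *: (wb + x) + (1 - t) *: (wb + y) = wb + (t *: x + (1 - t) *: y).
    by rewrite !scalerDr addrACA -scalerDl [t + _]addrC subrK scale1r.
  have t1' : 0 <= 1 - t by rewrite subr_ge0.
  have := ler_normD (t *: x) ((1 - t) *: y).
  rewrite !normrZ (ger0_norm t0) (ger0_norm t1') => /(ler_wpM2l (ltW eta0)).
  by rewrite /Gx; clear; lra.
(* [p.1] lists rational weights, tolerances and radii, and [p.2] is a threshold. The points [u] of
   [Om], within the radii of [b], bring the combined constraint below the threshold. *)
pose P (b : V) (p : seq (rat * rat * rat) * rat) (u : nat -> V) :=
  (forall i, (i < size p.1)%N -> Om (u i) /\ `|u i - b| <= ratr (nth 0 p.1 i).2) /\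
  cost b (rational_list p.1 u) + Gx (vec b (rational_list p.1 u)) < ratr p.2.
have /choice[W HW] : forall bp, exists u, (exists u', P bp.1 bp.2 u') -> P bp.1 bp.2 u.
  move=> bp; have [[u hu]|h] := pselect (exists u', P bp.1 bp.2 u').
    by exists u.
  by exists (fun=> wb).
(* Without a witness, or beyond the list, [wit] returns [b], so the orbit stays in [Om]; it is
   indexed by words over a countable alphabet. *)
pose wit (t : seq (rat * rat * rat) * rat * nat) (b : V) :=
  if `[< P b t.1 (W (b, t.1)) >] && (t.2 < size t.1.1)%N then W (b, t.1) t.2 else b.
pose D := foldr wit wb.
have OD s : Om (D s).
  elim: s => [//|t s IH] /=; rewrite /wit; case: ifP => // /andP[/asboolP[h _] ts].
  by have [] := h _ ts.
pose A := [set z | forall e : R, 0 < e -> exists s, `|D s - z| <= e].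
have AOm : A `<=` Om.
  by move=> z Az; apply: Oc => e /Az[s hs]; exists (D s).
have AD s : A (D s) by move=> e e0; exists s; rewrite subrr normr0 ltW.
have Ac : seq_closed A.
  move=> z hz e e0; have e2 : 0 < e / 2 by rewrite divr_gt0.
  have [y Ay yz] := hz _ e2; have [s sy] := Ay _ e2; exists s.
  have := ler_normD (D s - y) (y - z); rewrite addrA subrK.
  by move: yz sy; clear; lra.
have [w [f [Aw wwb fl fG fn]]] := fuzzy_exact A g L eta wb Vc Ac
  (dual_small_on_closure _ D Vcov) gc gL L0 (AD [::]) (fun z Az => gmin z (AOm z Az)) eta0.
have /choice[d Hd] : forall j : nat, exists d, 0 < d /\
    forall z, A z -> `|z - w| <= d -> f (z - w) <= j.+1%:R^-1 * `|z - w|.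
  move=> j; have j0 : 0 < j.+1%:R^-1 :> R by rewrite invr_gt0 ltr0n.
  by have [d d0 hd] := fn _ j0; exists d.
have d0 j : 0 < d j by have [] := Hd j.
(* Constraints on the sought functional. The factor [1 / 2] leaves room for replacing points of [Om]
   by witnesses still within [d j] of [w]. *)
pose K := [set l : seq (R * R * V) | forall c, c \in l -> exists j,
  [/\ 0 <= c.1.1, c.1.2 = j.+1%:R^-1, Om c.2 & `|c.2 - w| <= d j / 2]].
have claim l : K l -> 0 <= cost w l + Gx (vec w l).
  move=> Kl; rewrite leNgt; apply/negP => neg.
  pose gam := - (cost w l + Gx (vec w l)).
  have gam0 : 0 < gam by rewrite oppr_gt0.
  have M11 : 0 < 1 + M1 by rewrite ltr_pwDl.
  pose k := gam / (4 * (1 + M1)).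
  have k0 : 0 < k by rewrite divr_gt0// mulr_gt0.
  have kE : 4 * (k + M1 * k) = gam by rewrite /k; field; rewrite gt_eqF.
  have [s [u [rho [rho0 hs hc hv]]]] := rational_approx Om w d l k d0 k0 Kl.
  pose C := weight (rational_list s u).
  have C0 : 0 <= C by exact: weight_ge0.
  have CE (v : nat -> V) : weight (rational_list s v) = C by rewrite /C (weight_rational_list s v u).
  have C10 : 0 < C + 1 by rewrite ltr_wpDl.
  pose k' := k / (C + 1).
  have k'0 : 0 < k' by rewrite divr_gt0.
  have Ck' : C * k' <= k.
    have : (C + 1) * k' = k by rewrite /k' mulrC divfK// gt_eqF.
    by rewrite mulrDl mul1r; move: k'0; clear; lra.
  have mr : 0 < Num.min rho k' by rewrite lt_min rho0.
  have [t] := Aw _ mr; rewrite le_min => /andP[tr tk]; set b := D t in tr tk.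
  have tC : C * `|b - w| <= k by apply: le_trans Ck'; rewrite ler_wpM2l.
  have change x y (v : nat -> V) : C * `|y - x| <= k ->
     cost y (rational_list s v) + Gx (vec y (rational_list s v)) <=
     cost x (rational_list s v) + Gx (vec x (rational_list s v)) + gam / 4.
    move=> yx; have := cost_base x y (rational_list s v); rewrite CE.
    have := GxL (vec y (rational_list s v)) (vec x (rational_list s v)).
    have := vec_base x y (rational_list s v); rewrite CE => v1.
    have v2 := ler_wpM2l M10 (le_trans v1 yx).
    by rewrite -kE; move: v2 yx; clear; lra.
  have val_b : cost b (rational_list s u) + Gx (vec b (rational_list s u)) <= - gam / 2.
    have c1 := change w b u tC.
    have c2 := GxL (vec w (rational_list s u)) (vec w l).
    have c3 := ler_wpM2l M10 hv.
    have gE : cost w l + Gx (vec w l) = - gam by rewrite /gam opprK.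
    by move: c1 c2 c3 hc gE kE; clear; lra.
  have gam24 : - gam / 2 < - gam / 4 by move: gam0; clear; lra.
  have [th thi] := rat_in_itvoo gam24.
  have /andP[th1 th2] : - gam / 2 < ratr th < - gam / 4 by move: thi; rewrite in_itv.
  (* The rational list is admissible at the nearby orbit point [b], so the chosen points at [b] are
     genuine witnesses; being orbit points, they lie in [A]. *)
  have PW : P b (s, th) (W (b, (s, th))).
    apply: (HW (b, (s, th))); exists u; split=> /=; last exact: le_lt_trans th1.
    move=> i si; have [j [_ _ Oui [r1 r2]]] := hs i si; split=> //.
    have := ler_normD (u i - w) (w - b); rewrite addrA subrK [`|w - b|]distrC.
    by move: r1 tr; clear; lra.
  set u' := W _ in PW.
  have u'A i : (i < size s)%N -> A (u' i).
    move=> si; have -> : u' i = D ((s, th, i) :: t); last exact: AD.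
    by rewrite /= /wit /= -/b si andbT; case: asboolP.
  have [hu' val'] := PW; rewrite /= in hu' val'.
  have wb' : C * `|w - b| <= k by rewrite distrC.
  have := change b w u' wb'.
  have : f (vec w (rational_list s u')) <= cost w (rational_list s u').
    apply: linear_form_vec_le => // c /rational_listP[i si ->] /=.
    have [j [x0 xj _ [r1 r2]]] := hs i si; split=> //; rewrite xj.
    have [_ hd] := Hd j; apply: hd; first exact: u'A.
    have := ler_normD (u' i - b) (b - w); rewrite addrA subrK.
    by move: (hu' i si).2 tr r2; clear; lra.
  have := fG (vec w (rational_list s u')); rewrite -/(Gx _).
  by move: val' th2; clear; lra.
(* For a linear minorant [f'] of [k |-> inf (S k)], the empty list gives [- f' h <= Gx h], and one
   constraint of weight [t] gives normality up to the constant [Gx 0 = eta], removed by scaling. *)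
pose S k := [set cost w l + Gx (vec w l - k) | l in K].
have K0 : K [::] by move=> c; rewrite in_nil.
have Sn k : S k !=set0 by exists (cost w [::] + Gx (vec w [::] - k)), [::].
have Sb k s : S k s -> - (M1 * `|k|) <= s.
  case=> l Kl <-; have := claim l Kl; have := GxL (vec w l) (vec w l - k).
  by rewrite opprB addrCA subrr addr0; clear; lra.
have Slb k := (inf_approx _ _ (Sn k) (Sb k)).1.
have Sap k := (inf_approx _ _ (Sn k) (Sb k)).2.
have [||f' f'l f'Q] := convex_linear_minorant (fun k => inf (S k)).
- move=> x y t ht; have /andP[t0 t1] := ht; apply: le_of_approx => e e0.
  have t1' : 0 <= 1 - t by rewrite subr_ge0.
  have [_ [l1 K1 <-] h1] := Sap x _ e0; have [_ [l2 K2 <-] h2] := Sap y _ e0.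
  pose sc a (l : seq (R * R * V)) := [seq (a * c.1.1, c.1.2, c.2) | c <- l].
  have Ksc a l : 0 <= a -> K l -> K (sc a l).
    move=> a0 Kl _ /mapP[c /Kl[j [c1 c2 c3 c4]] ->]; exists j; split=> //=.
    exact: mulr_ge0.
  have csc a l : cost w (sc a l) = a * cost w l.
    by rewrite /cost big_map mulr_sumr; apply: eq_bigr => c _ /=; rewrite -mulrA.
  have vsc a l : vec w (sc a l) = a *: vec w l.
    by rewrite /vec big_map scaler_sumr; apply: eq_bigr => c _ /=; rewrite scalerA.
  pose l := sc t l1 ++ sc (1 - t) l2.
  have Kl : K l.
    move=> c; rewrite mem_cat => /orP[cl|cl]; first exact: (Ksc t l1 t0 K1 c cl).
    exact: (Ksc _ l2 t1' K2 c cl).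
  have cl : cost w l = t * cost w l1 + (1 - t) * cost w l2.
    by rewrite {1}/cost big_cat /= -!/(cost w _) !csc.
  have vl : vec w l - (t *: x + (1 - t) *: y) =
      t *: (vec w l1 - x) + (1 - t) *: (vec w l2 - y).
    by rewrite {1}/vec big_cat /= -!/(vec w _) !vsc !scalerBr opprD addrACA.
  have : inf (S (t *: x + (1 - t) *: y)) <= cost w l + Gx (vec w l - (t *: x + (1 - t) *: y)).
    by apply: Slb; exists l.
  rewrite vl cl; have := Gxc (vec w l1 - x) (vec w l2 - y) t ht.
  have := ler_wpM2l t0 (ltW h1); have := ler_wpM2l t1' (ltW h2).
  by clear; lra.
- apply: lb_le_inf => // _ [l Kl <-]; rewrite subr0; exact: claim.
have f'G h : - f' h <= Gx h.
  rewrite -(linear_formN f' _ f'l); apply: le_trans (f'Q _) _; apply: Slb.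
  by exists [::] => //; rewrite /cost /vec !big_nil add0r opprK add0r.
exists w, f'; split=> //.
- exact: AOm.
- split=> // h; apply: (@le_of_scaling _ _ _ eta) => t t0.
  have := f'G (- (t *: h)); rewrite (linear_formN f' _ f'l) opprK.
  rewrite (linear_formZ f' _ _ f'l) => /le_trans; apply.
  have := GxL (- (t *: h)) 0; rewrite Gx0 subr0 normrN normrZ (gtr0_norm t0) -/M1.
  by clear; lra.
move=> eps eps0; pose j := Num.truncn eps^-1.
have je : j.+1%:R^-1 <= eps.
  rewrite -[leRHS]invrK lef_pV2 ?posrE ?invr_gt0 ?ltr0n//.
  by apply: ltW; exact: truncnS_gt.
exists (d j / 2) => [|z Oz zd]; first by rewrite divr_gt0.
apply: (@le_trans _ _ (j.+1%:R^-1 * `|z - w|)); last by rewrite ler_wpM2r.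
apply: (@le_of_scaling _ _ _ eta) => t t0.
rewrite -(linear_formZ f' _ _ f'l); apply: le_trans (f'Q _) _; apply: Slb.
exists [:: (t, j.+1%:R^-1, z)].
  by move=> c; rewrite inE => /eqP ->; exists j; split=> //=; exact: ltW.
by rewrite /cost /vec !big_seq1 /= subrr Gx0.
Qed.

End FuzzyNormal.

(** * The distance to the negative cone *)

(** Hahn-Banach for [k |-> inf_m (p (k + m) + q m - f m)]: taking [m = 0] bounds [f1] by [p], and
    [m = - k] bounds [f - f1] by [q]. *)
Lemma sublinear_sandwich {R : realType} (V : lmodType R) (p q f : V -> R) :
  sublinear p -> sublinear q -> linear_form f ->
  (forall x, f x <= p x + q x) ->
  exists f1, [/\ linear_form f1, forall x, f1 x <= p x &
                 forall x, f x - f1 x <= q x].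
Proof.
move=> ps qs fl fpq.
pose S k := range (fun m => p (k + m) + q m - f m).
have Sn k : S k !=set0 by exists (p (k + 0) + q 0 - f 0), 0.
have Sb k s : S k s -> - p (- k) <= s.
  case=> m _ <-; have := ps.1 (k + m) (- k); rewrite addrC addKr.
  by have := fpq m; lra.
have Slb k := (inf_approx _ _ (Sn k) (Sb k)).1.
have Sap k := (inf_approx _ _ (Sn k) (Sb k)).2.
have [|f1 f1l f1Q] := hahn_banach (fun k => inf (S k)).
  split=> [x y|t x t0]; apply: le_of_approx => e e0.
    have e2 : 0 < e / 2 by rewrite divr_gt0.
    have [_ [m1 _ <-] h1] := Sap x _ e2; have [_ [m2 _ <-] h2] := Sap y _ e2.
    have : inf (S (x + y)) <= p (x + y + (m1 + m2)) + q (m1 + m2) - f (m1 + m2).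
      by apply: Slb; exists (m1 + m2).
    rewrite addrACA (linear_formD f _ _ fl).
    have := ps.1 (x + m1) (y + m2); have := qs.1 m1 m2.
    by move: h1 h2; clear; lra.
  have et : 0 < e / t by rewrite divr_gt0.
  have [_ [m _ <-] h] := Sap x _ et.
  have : inf (S (t *: x)) <= p (t *: x + t *: m) + q (t *: m) - f (t *: m).
    by apply: Slb; exists (t *: m).
  rewrite -scalerDr (linear_formZ f _ _ fl) (sublinearZ p _ _ ps (ltW t0)).
  rewrite (sublinearZ q _ _ qs (ltW t0)) => /le_trans; apply.
  have := ler_wpM2l (ltW t0) (ltW h).
  have -> : t * (inf (S x) + e / t) = t * inf (S x) + e.
    by field; rewrite gt_eqF.
  by clear; lra.
exists f1; split=> // x.
  apply: le_trans (f1Q x) _.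
  have := Slb x _ (ex_intro2 _ _ 0 Logic.I erefl).
  by rewrite addr0 (sublinear0 q qs) (linear_form0 f fl) addr0 subr0.
have := f1Q (- x).
have := Slb (- x) _ (ex_intro2 _ _ x Logic.I erefl).
rewrite addNr (sublinear0 p ps) (linear_formN f1 _ f1l).
by clear; lra.
Qed.

Section ConeDistance.
Context {R : realType} {Y : normedModType R}.
Variable C : set Y.
Hypothesis CC : proper_closed_convex_cone C.

Let C0 : C 0. Proof. exact: CC.1. Qed.
Let CZ t k : 0 <= t -> C k -> C (t *: k). Proof. exact: CC.2.1. Qed.
Let CD k l : C k -> C l -> C (k + l). Proof. exact: CC.2.2.1. Qed.

Definition neg_cone_dist (v : Y) : R := inf [set `|v + k| | k in C].
Local Notation phi := neg_cone_dist.

Lemma neg_cone_distP v : (forall k, C k -> phi v <= `|v + k|) /\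
  (forall e, 0 < e -> exists2 k, C k & `|v + k| < phi v + e).
Proof.
have [lb ap] := @inf_approx R [set `|v + k| | k in C] 0
  (ex_intro _ _ (ex_intro2 _ _ 0 C0 erefl)) (ltac:(by move=> _ [k _ <-])).
split=> [k Ck|e /ap[_ [k Ck <-] h]]; last by exists k.
by apply: lb; exists k.
Qed.

Lemma neg_cone_dist_ge0 v : 0 <= phi v.
Proof. by apply: lb_le_inf => [|_ [k _ <-]//]; exists `|v + 0|, 0. Qed.

Lemma neg_cone_dist_le v : phi v <= `|v|.
Proof. by have := (neg_cone_distP v).1 0 C0; rewrite addr0. Qed.

Lemma neg_cone_distN k : C k -> phi (- k) = 0.
Proof.
move=> Ck; apply/eqP; rewrite eq_le neg_cone_dist_ge0 andbT.
by have := (neg_cone_distP (- k)).1 k Ck; rewrite addNr normr0.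
Qed.

Lemma neg_cone_dist_sublinear : sublinear phi.
Proof.
split=> [x y|t x t0]; apply: le_of_approx => e e0.
  have e2 : 0 < e / 2 by rewrite divr_gt0.
  have [k Ck hk] := (neg_cone_distP x).2 _ e2.
  have [l Cl hl] := (neg_cone_distP y).2 _ e2.
  have := (neg_cone_distP (x + y)).1 _ (CD _ _ Ck Cl); rewrite addrACA.
  by have := ler_normD (x + k) (y + l); lra.
have [k Ck hk] := (neg_cone_distP x).2 _ (divr_gt0 e0 t0).
have := (neg_cone_distP (t *: x)).1 _ (CZ _ _ (ltW t0) Ck).
rewrite -scalerDr normrZ (gtr0_norm t0) => /le_trans; apply.
have := ler_wpM2l (ltW t0) (ltW hk).
have -> : t * (phi x + e / t) = t * phi x + e by field; rewrite gt_eqF.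
by [].
Qed.

Lemma neg_cone_dist_lip : lip 1 phi.
Proof.
move=> x y; have := neg_cone_dist_sublinear.1 (x - y) y; rewrite subrK.
by have := neg_cone_dist_le (x - y); lra.
Qed.

Lemma neg_cone_dist_eq0 v : phi v = 0 -> C (- v).
Proof.
move=> v0; have Cc : closed C by exact: CC.2.2.2.1.
apply: Cc => B /nbhs_normP[e /= e0 eB].
have [k Ck hk] := (neg_cone_distP v).2 _ e0; exists k; split=> //.
apply: eB; rewrite /ball_/= -opprD normrN; move: hk; rewrite v0 add0r; done.
Qed.

End ConeDistance.

(** * Dual norms and approximate subgradients of the distance *)

Section DualNorm.
Context {R : realType} {V : normedModType R}.

Lemma dnorm_le (f : V -> R) M : 0 <= M -> (forall x, `|f x| <= M * `|x|) ->
  dnorm f <= M.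
Proof.
move=> M0 fM; apply: ge_sup; first by exists `|f 0|, 0 => //=; rewrite normr0.
move=> _ [x /= x1 <-]; apply: le_trans (fM x) _.
by rewrite -[leRHS]mulr1 ler_wpM2l.
Qed.

Lemma le_dnorm (f : V -> R) M x : linear_form f -> (forall x, `|f x| <= M * `|x|) ->
  `|f x| <= dnorm f * `|x|.
Proof.
move=> fl fM; have [->|x0] := eqVneq x 0.
  by rewrite (linear_form0 f fl) !normr0 mulr0.
have nx : 0 < `|x| by rewrite normr_gt0.
rewrite -ler_pdivrMr//; apply: ub_le_sup.
  exists `|M| => _ [y /= y1 <-]; apply: le_trans (fM y) _.
  apply: le_trans (ler_norm _) _; rewrite normrM normr_id -[leRHS]mulr1.
  by rewrite ler_wpM2l.
exists (`|x|^-1 *: x) => /=.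
  by rewrite normrZ normfV normr_id mulVf// gt_eqF.
by rewrite (linear_formZ f _ _ fl) normrM normfV normr_id mulrC.
Qed.

End DualNorm.

(* The subgradients of the distance to [- C] at a point outside [- C] are unit
   vectors of the dual cone; an approximate subgradient is close to one. *)
Lemma near_unit_dual_cone {R : realType} (Y : normedModType R) (C : set Y)
    (ws : Y -> R) (vb : Y) (k eta : R) :
  proper_closed_convex_cone C -> 0 < neg_cone_dist C vb -> 0 < k <= 16^-1 ->
  0 < eta -> eta <= k -> eta <= k * neg_cone_dist C vb -> linear_form ws ->
  (forall h, ws h <= neg_cone_dist C (vb + h) - neg_cone_dist C vb
                     + k * `|h| + eta * (1 + `|h|)) ->
  exists ys : Y -> R, [/\ in_dual_cone C ys, dnorm ys = 1,
    forall h, `|ws h - ys h| <= 8 * k * `|h| & 1 - 8 * k <= dnorm ws].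
Proof.
move=> CC; set phi := neg_cone_dist C => vb0 /andP[k0 k16] eta0 etak etav wsl wsle.
have phis := neg_cone_dist_sublinear C CC.
have phile := neg_cone_dist_le C CC.
have ws1 h : ws h <= phi h + 2 * k * `|h|.
  apply: (@le_of_scaling _ _ _ eta) => t t0.
  have := wsle (t *: h); have := phis.1 vb (t *: h); rewrite -/phi.
  rewrite (linear_formZ ws _ _ wsl) (sublinearZ phi _ _ phis (ltW t0)).
  rewrite normrZ (gtr0_norm t0).
  have := ler_wpM2r (mulr_ge0 (ltW t0) (normr_ge0 h)) etak.
  by clear; lra.
have ns : sublinear (fun h : Y => 2 * k * `|h|).
  split=> [x y|t x t0].
    by rewrite -mulrDr ler_wpM2l ?ler_normD// mulr_ge0// ltW.
  by rewrite normrZ (gtr0_norm t0) mulrCA.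
(* [ws] splits into a part below the distance, hence of norm at most one and nonnegative on [C], and
   a remainder of norm at most [2 k]. *)
have [y1 [y1l y1p y1w]] := sublinear_sandwich Y phi _ ws phis ns wsl ws1.
have y1n x : `|y1 x| <= 1 * `|x|.
  rewrite mul1r ler_norml (le_trans (y1p x) (phile x)) andbT.
  by have := le_trans (y1p (- x)) (phile (- x)); rewrite (linear_formN y1 _ y1l) normrN; lra.
have y1w' x : `|ws x - y1 x| <= 2 * k * `|x|.
  have := y1w (- x); rewrite (linear_formN y1 _ y1l) (linear_formN ws _ wsl) normrN.
  by rewrite ler_norml y1w andbT; clear; lra.
have wsn x : `|ws x| <= 2 * `|x|.
  have := ler_normD (ws x - y1 x) (y1 x); rewrite subrK.
  have := ler_wpM2r (normr_ge0 x) k16.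
  by move: (y1n x) (y1w' x) (normr_ge0 x); clear; lra.
(* [- c1] is a nearly closest point of [- C]. Moving from [vb] by [- e] brings the distance to zero,
   so [ws e] is nearly [|e|], which bounds the norms from below. *)
have [c1 Cc1 hc1] := (neg_cone_distP C CC vb).2 _ (mulr_gt0 k0 vb0).
set e := vb + c1 in hc1; rewrite -/phi in hc1.
have ev : phi vb <= `|e| by exact: (neg_cone_distP C CC vb).1.
have e0 : 0 < `|e| by exact: lt_le_trans ev.
have wse : phi vb - k * `|e| - eta * (1 + `|e|) <= ws e.
  have := wsle (- e); rewrite (linear_formN ws _ wsl) normrN.
  by rewrite /e opprD addrA subrr add0r (neg_cone_distN C CC _ Cc1 : phi (- c1) = 0); clear; lra.
have wse2 : (1 - 4 * k) * `|e| <= ws e.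
  have := ler_wpM2r (ltW e0) etak.
  have : k * phi vb <= k * `|e| by rewrite ler_pM2l.
  by move: wse etav hc1; clear; lra.
have y1e : (1 - 6 * k) * `|e| <= y1 e.
  by have := y1w e; move: wse2; clear; lra.
pose n := dnorm y1.
have ne x : `|y1 x| <= n * `|x| by exact: (le_dnorm _ 1).
have n1 : n <= 1 by exact: dnorm_le.
have n6 : 1 - 6 * k <= n.
  rewrite -(ler_pM2r e0); apply: le_trans y1e _.
  exact: le_trans (ler_norm _) (ne e).
have n0 : 0 < n by move: n6 k16; clear; lra.
have nV : 0 < n^-1 by rewrite invr_gt0.
have yle x : `|n^-1 * y1 x| <= 1 * `|x|.
  by rewrite normrM (gtr0_norm nV) ler_pdivrMl// mul1r.
have yl : linear_form (fun x => n^-1 * y1 x) by move=> a u v; rewrite y1l; ring.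
(* Dividing by [n], which lies between [1 - 6 k] and [1], makes the norm one and changes [y1] by at
   most [6 k]. *)
exists (fun x => n^-1 * y1 x); split.
- split=> [|y Cy].
    apply: (dual_le_is_dual 1); split=> // x; exact: le_trans (ler_norm _) (yle x).
  rewrite mulr_ge0 ?(ltW nV)// -oppr_le0 -(linear_formN y1 _ y1l).
  by apply: le_trans (y1p _) _; rewrite /phi (neg_cone_distN C CC).
- apply/eqP; rewrite eq_le dnorm_le//=.
  set m := dnorm _.
  have nm : n <= n * m.
    apply: dnorm_le => [|x].
      rewrite mulr_ge0 ?(ltW n0)//.
      have := le_dnorm _ 1 e yl yle; rewrite -/m => /(le_trans (normr_ge0 _)).
      by rewrite pmulr_lge0.
    have := le_dnorm _ 1 x yl yle; rewrite -/m normrM (gtr0_norm nV).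
    by rewrite ler_pdivrMl// mulrA.
  by rewrite -(ler_pM2l n0) mulr1.
- move=> h.
  have -> : ws h - n^-1 * y1 h = (ws h - y1 h) + (1 - n^-1) * y1 h by ring.
  apply: le_trans (ler_normD _ _) _.
  have : `|(1 - n^-1) * y1 h| <= 6 * k * `|h|.
    have -> : (1 - n^-1) * y1 h = (n - 1) * (n^-1 * y1 h).
      by field; rewrite gt_eqF.
    rewrite normrM; apply: ler_pM => //.
      by rewrite ler_norml; move: n1 n6 k0; clear; lra.
    by have := yle h; rewrite mul1r.
  by move: (y1w' h); clear; lra.
have := le_dnorm ws 2 e wsl wsn => /(le_trans (ler_norm _))/(le_trans wse2).
rewrite ler_pM2r//; move: k0; clear; lra.
Qed.

(** * The solution estimate for a fixed parameter *)

Lemma closed_seq_closed {R : realType} (V : normedModType R) (A : set V) :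
  closed A -> seq_closed A.
Proof.
move=> Ac z hz; apply: Ac => B /nbhs_normP[e /= e0 eB].
have [w Aw wz] := hz (e / 2) (divr_gt0 e0 (ltr0n _ 2)).
exists w; split=> //; apply: eB; rewrite /ball_/= distrC.
by apply: le_lt_trans wz _; lra.
Qed.

(** [G] stands for the graph of [F] at one parameter; [r0] is chosen before [G], which makes the
    estimate uniform in the parameter. *)
Lemma solution_estimate {R : realType} (X Y : completeNormedModType R)
    (C : set Y) (xbar : X) (r a c : R) :
  asplund X -> asplund Y -> proper_closed_convex_cone C -> 0 < r -> 0 < a < c ->
  exists2 r0, 0 < r0 & forall G : set (X * Y), closed G ->
    (forall x y, G (x, y) -> `|x - xbar| < r -> `|y| < r ->
       forall ys zs : Y -> R, in_dual_cone C ys -> dnorm ys = 1 ->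
       is_dual zs -> dnorm zs < 2 * c ->
       forall xs : X -> R, frechet_coderiv G x y (fun v => ys v + zs v) xs ->
         c * dnorm (fun v => ys v + zs v) <= dnorm xs) ->
    forall x y, G (x, y) -> `|x - xbar| < r0 -> `|y| < r0 ->
      exists u v, [/\ G (u, v), C (- v) & `|x - u| <= a^-1 * `|y| ].
Proof.
move=> XA YA CC r0 /andP[a0 ac].
have c0 : 0 < c by exact: lt_trans ac.
(* The three bounds serve [near_unit_dual_cone], the condition [dnorm zs < 2 * c], and the final
   contradiction [a + k < c (1 - 8 k)]. *)
pose k := Num.min (16^-1) (Num.min (c / 8) ((c - a) / (2 * (1 + 8 * c)))).
have c8 : 0 < 2 * (1 + 8 * c) by lra.
have k0 : 0 < k by rewrite !lt_min invr_gt0 ltr0n !divr_gt0// subr_gt0.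
have k16 : k <= 16^-1 by rewrite ge_min lexx.
have kc : 8 * k <= c.
  have : k <= c / 8 by rewrite !ge_min lexx orbT.
  by clear; lra.
have kca : k * (2 * (1 + 8 * c)) <= c - a.
  by rewrite -ler_pdivlMr// !ge_min lexx !orbT.
(* The Ekeland point then stays within [r / 2] of [(xbar, 0)] in each coordinate, leaving room for a
   move by [eta <= r / 4]. *)
pose r1 := r / 2 / (1 + a^-1 + k^-1).
have ai0 : 0 < a^-1 by rewrite invr_gt0.
have ki0 : 0 < k^-1 by rewrite invr_gt0.
have d0 : 0 < 1 + a^-1 + k^-1 by lra.
have r10 : 0 < r1 by rewrite !divr_gt0.
have r1E : r1 + a^-1 * r1 + k^-1 * r1 = r / 2.
  have : r1 * (1 + a^-1 + k^-1) = r / 2 by rewrite /r1 divfK// gt_eqF.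
  by move=> <-; ring.
exists r1 => // G Gc Giii x y Gxy xr yr.
have phile := neg_cone_dist_le C CC; have phige := neg_cone_dist_ge0 C CC.
have philip := neg_cone_dist_lip C CC; have phis := neg_cone_dist_sublinear C CC.
set phi := neg_cone_dist C in phile phige philip phis.
have Zc : seq_complete (X * Y)%type.
  by apply: prod_seq_complete; exact: complete_seq_complete.
have Zcov : dual_covered (X * Y)%type.
  by apply: prod_dual_covered => I e eps M e0 M0; exact: asplund_dual_covered.
have Gsc := closed_seq_closed _ _ Gc.
(* The weight [a] on [X] produces the factor [a^-1]; the weight [k] on [Y] is small so as to perturb
   the subgradients of [phi] little. *)
pose N (z : X * Y) := a * `|z.1| + k * `|z.2|.
have ND z1 z2 : N (z1 + z2) <= N z1 + N z2.
  have := ler_wpM2l (ltW a0) (ler_normD z1.1 z2.1).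
  have := ler_wpM2l (ltW k0) (ler_normD z1.2 z2.2).
  by rewrite /N/=; clear; lra.
have NN z : N (- z) = N z by rewrite /N/= !normrN.
have mN z : Num.min a k * `|z| <= N z.
  have [h1 h2 _] := prod_norm_le _ _ z.
  rewrite prod_normE; case: (leP `|z.1| `|z.2|) => _.
    apply: (@le_trans _ _ (k * `|z.2|)).
      by rewrite ler_wpM2r// ge_min lexx orbT.
    by rewrite /N lerDr mulr_ge0// ltW.
  apply: (@le_trans _ _ (a * `|z.1|)).
    by rewrite ler_wpM2r// ge_min lexx.
  by rewrite /N lerDl mulr_ge0// ltW.
have NM z : N z <= (a + k) * `|z|.
  have [h1 h2 _] := prod_norm_le _ _ z.
  by rewrite mulrDl lerD// ler_wpM2l// ltW.
have m0 : 0 < Num.min a k by rewrite lt_min a0.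
have phL : lip 1 (fun z : X * Y => phi z.2).
  move=> z1 z2; apply: le_trans (philip _ _) _; rewrite ler_wpM2l//.
  by have [_ h _] := prod_norm_le _ _ (z1 - z2).
have [[ub vb] [Gb hb bmin]] := ekeland G N (fun z => phi z.2) (Num.min a k) (a + k)
  1 0 (x, y) Zc Gsc m0 ND NN mN NM phL (fun z _ => phige _) Gxy.
have [hbx hby] : a * `|ub - x| <= `|y| /\ k * `|vb - y| <= `|y|.
  have := hb; rewrite /N/=; have := phile y; have := phige vb.
  have := mulr_ge0 (ltW a0) (normr_ge0 (ub - x)).
  have := mulr_ge0 (ltW k0) (normr_ge0 (vb - y)).
  by clear; lra.
have ubx : `|ub - x| <= a^-1 * `|y| by rewrite ler_pdivlMl.
have vby : `|vb - y| <= k^-1 * `|y| by rewrite ler_pdivlMl.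
have [v0|vn0] := eqVneq (phi vb) 0.
  exists ub, vb; split=> //; last by rewrite distrC.
  exact: neg_cone_dist_eq0 v0.
have v0 : 0 < phi vb by rewrite lt_neqAle eq_sym vn0 phige.
exfalso.
pose g (z : X * Y) := phi z.2 + N (z - (ub, vb)).
have gc : convex_fun_on setT g.
  move=> z1 z2 t _ _ /andP[t0 t1].
  have t1' : 0 <= 1 - t by rewrite subr_ge0.
  have := phis.1 (t *: z1.2) ((1 - t) *: z2.2).
  rewrite (sublinearZ phi _ _ phis t0) (sublinearZ phi _ _ phis t1').
  have := ND (t *: (z1 - (ub, vb))) ((1 - t) *: (z2 - (ub, vb))).
  have NZ s z : 0 <= s -> N (s *: z) = s * N z.
    by move=> s0; rewrite /N/= !normrZ (ger0_norm s0); ring.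
  rewrite !NZ// !scalerBr addrACA -opprD -scalerDl [t + _]addrC subrK scale1r.
  by rewrite /g/=; clear; lra.
have gL : lip (1 + (a + k)) g.
  move=> z1 z2; have := phL z1 z2; have := NM (z1 - z2).
  have := ND (z1 - z2) (z2 - (ub, vb)); rewrite addrA subrK.
  by rewrite /g mulrDl; clear; lra.
have L0 : 0 <= 1 + (a + k) by move: a0 k0; clear; lra.
have N0 : N 0 = 0 by rewrite /N/= !normr0 !mulr0 addr0.
have gb : g (ub, vb) = phi vb by rewrite /g subrr N0 addr0.
have gE z : g ((ub, vb) + z) = phi (vb + z.2) + N z.
  by rewrite /g [X in N X](_ : _ = z)// addrC addKr.
have gmin z : G z -> g (ub, vb) <= g z by move=> Gz; rewrite gb; exact: bmin.
pose eta := Num.min k (Num.min (k * phi vb) (r / 4)).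
have eta0 : 0 < eta by rewrite lt_min k0 lt_min mulr_gt0//= divr_gt0.
have etak : eta <= k by rewrite ge_min lexx.
have etav : eta <= k * phi vb.
  by rewrite ge_min; apply/orP; right; rewrite ge_min lexx.
have etar : eta <= r / 4.
  by rewrite ge_min; apply/orP; right; rewrite ge_min lexx orbT.
have [[u1 v1] [f [G1 w1 fM fg fn]]] := fuzzy_normal G g _ eta (ub, vb) Zc Zcov Gsc gc
  gL L0 Gb gmin eta0.
have fl := fM.1.
(* The normal is [(xs, - ws)], so [xs] is in the coderivative at [ws]. The subgradient inequality
   separates into the bound [a + k] for [xs] and an approximate subgradient inequality of [phi] for
   [ws]. *)
pose xs (h : X) := f (h, 0); pose ws (h : Y) := - f (0, h).
have xsl : linear_form xs.
  by move=> s h1 h2; rewrite /xs -fl; congr f; congr pair; rewrite /= scaler0 addr0.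
have wsl : linear_form ws.
  move=> s h1 h2; rewrite /ws; have -> : (0 : X, s *: h1 + h2) = s *: (0 : X, h1) + (0, h2).
    by congr pair; rewrite /= scaler0 addr0.
  by rewrite fl; ring.
have fE h1 h2 : f (h1, h2) = xs h1 - ws h2.
  by rewrite /xs /ws opprK -linear_formD//; congr f; congr pair; rewrite /= ?addr0 ?add0r.
have xs1 h : - xs h <= (a + k) * `|h|.
  apply: (@le_of_scaling _ _ _ eta) => t t0; rewrite mulrN -(linear_formZ xs _ _ xsl).
  have := fg (t *: h, 0); rewrite gb gE /N/= addr0 normr0 mulr0 addr0.
  have nE : `|((t *: h, 0) : X * Y)| = t * `|h|.
    rewrite prod_normE/= normr0 normrZ (gtr0_norm t0).
    by rewrite (elimT max_idPl)// mulr_ge0// ltW.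
  rewrite nE normrZ (gtr0_norm t0).
  have := ler_wpM2r (mulr_ge0 (ltW t0) (normr_ge0 h)) etak.
  by rewrite -/(xs _); clear; lra.
have xs2 h : `|xs h| <= (a + k) * `|h|.
  rewrite ler_norml; have := xs1 h; have := xs1 (- h).
  by rewrite (linear_formN xs _ xsl) normrN opprK => -> ; rewrite lerNl => ->.
have wsle h : ws h <= phi (vb + h) - phi vb + k * `|h| + eta * (1 + `|h|).
  have := fg (0, h); rewrite gb gE /N/= normr0 mulr0 add0r.
  have nE : `|((0, h) : X * Y)| = `|h|.
    by rewrite prod_normE/= normr0 (elimT max_idPr).
  by rewrite nE -/(ws h); clear; lra.
have k1 : 0 < k <= 16^-1 by rewrite k0.
have [ys [ysC ys1 wys wsn]] := near_unit_dual_cone Y C ws vb k eta CC v0 k1 eta0 etak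
  etav wsl wsle.
have ysl : linear_form ys by exact: ysC.1.1.
pose zs v := ws v - ys v.
have yzE : (fun v => ys v + zs v) = ws.
  by apply/funext => v; rewrite /zs addrC subrK.
have k80 : 0 <= 8 * k by move: k0; clear; lra.
have [w11 w12 _] := prod_norm_le _ _ ((u1, v1) - (ub, vb)); rewrite /= in w11 w12.
have u1r : `|u1 - xbar| < r.
  have := ler_normD (u1 - ub) (ub - x); rewrite addrA subrK.
  have := ler_normD (u1 - x) (x - xbar); rewrite addrA subrK.
  have : a^-1 * `|y| <= a^-1 * r1 by rewrite ler_pM2l// ltW.
  have : 0 < k^-1 * r1 by rewrite mulr_gt0.
  by move: w11 w1 etar ubx xr r1E r0; clear; lra.
have v1r : `|v1| < r.
  have := ler_normD (v1 - vb) (vb - y); rewrite addrA subrK.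
  have := ler_normD (v1 - y) y; rewrite subrK.
  have : k^-1 * `|y| <= k^-1 * r1 by rewrite ler_pM2l// ltW.
  have : 0 < a^-1 * r1 by rewrite mulr_gt0.
  by move: w12 w1 etar vby yr r1E r0; clear; lra.
have zsd : is_dual zs.
  apply: (dual_le_is_dual (8 * k)); split=> [s h1 h2|h].
    by rewrite /zs wsl ysl; ring.
  exact: le_trans (ler_norm _) (wys h).
have zsn : dnorm zs < 2 * c.
  apply: le_lt_trans (dnorm_le zs (8 * k) k80 wys) _.
  by move: kc c0; clear; lra.
have xsd : frechet_coderiv G u1 v1 (fun v => ys v + zs v) xs.
  split.
    apply: (dual_le_is_dual (a + k)); split=> // h.
    exact: le_trans (ler_norm _) (xs2 h).
  move=> eps eps0; have [d dp hd] := fn eps eps0; exists d; split=> // u v Guv uvd.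
  have [_ _ nle] := prod_norm_le _ _ ((u, v) - (u1, v1)); rewrite /= in nle.
  have := hd (u, v) Guv (le_trans nle (ltW uvd)).
  have -> : (u, v) - (u1, v1) = (u - u1, v - v1) by [].
  rewrite fE.
  have -> : ys (v - v1) + zs (v - v1) = ws (v - v1) by rewrite /zs addrC subrK.
  by move=> /le_trans; apply; rewrite ler_pM2l.
(* This gives [c (1 - 8 k) <= dnorm xs <= a + k], against the choice of [k]. *)
have := Giii u1 v1 G1 u1r v1r ys zs ysC ys1 zsd zsn xs xsd; rewrite yzE.
have : dnorm xs <= a + k by apply: dnorm_le => //; move: a0 k0; clear; lra.
have := ler_wpM2l (ltW c0) wsn.
by move: kca k0 ac; clear; lra.
Qed.

Theorem theorem3p5 (R : realType) (X Y : completeNormedModType R)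
  (P : topologicalType) (C : set Y) (F : X -> P -> set Y) (xbar : X) (pbar : P)
  (r c : R) (U2 : set P) :
  asplund X -> asplund Y -> proper_closed_convex_cone C -> F xbar pbar 0 ->
  (* (i) *)
  (exists U1, nbhs pbar U1 /\
     forall p, U1 p -> closed [set xy : X * Y | F xy.1 p xy.2]) ->
  (* (ii) inner semicontinuity of F at ((xbar,pbar),0) *)
  (forall D : set Y, open D -> D 0 ->
     exists W : set (X * P), nbhs (xbar, pbar) W /\
       forall w, W w -> F w.1 w.2 `&` D !=set0) ->
  (* (iii) *)
  0 < r -> 0 < c -> nbhs pbar U2 ->
  (forall p, U2 p -> forall (x : X) (y : Y), F x p y ->
       `|x - xbar| < r -> `|y| < r ->
       forall ys zs : Y -> R, in_dual_cone C ys -> dnorm ys = 1 ->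
       is_dual zs -> dnorm zs < 2 * c ->
       forall xs : X -> R,
         frechet_coderiv [set xy : X * Y | F xy.1 p xy.2] x y
           (fun v => ys v + zs v) xs ->
         c * dnorm (fun v => ys v + zs v) <= dnorm xs) ->
  let H := fun x p => [set y + k | y in F x p & k in C] in
  let S := fun p => [set x | H x p 0] in
  (forall a : R, 0 < a < c ->
     exists (U : set P) (tau : R), nbhs pbar U /\ 0 < tau /\
       forall (x : X) (p : P), `|x - xbar| < tau -> U p ->
         (dist_set x (S p) <= (a^-1)%:E * dist_set (0%R : Y) (F x p))%E)
  /\
  (forall dP : P -> P -> R, metric_of dP ->
   forall a : R, 0 < a < c ->
     exists tau0 gamma0 : R, 0 < tau0 /\ 0 < gamma0 /\
       forall (x : X) (p : P), `|x - xbar| < tau0 -> dP pbar p < gamma0 ->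
         (ereal_inf [set (dP p w.1 + `|x - w.2|)%:E
                     | w in [set w : P * X | S w.1 w.2]]
          <= (1 + a^-1)%:E *
             ereal_inf [set (`|x - w.1.1| + dP p w.1.2 + `|(0%R : Y) - w.2|)%:E
                     | w in [set w : (X * P) * Y | F w.1.1 w.1.2 w.2]])%E).
Proof.
move=> XA YA CC F0 [U1 [nU1 cU1]] isc r0 c0 nU2 iii H S.
have SE p u v : F u p v -> C (- v) -> S p u.
  by move=> Fv Cv; exists v => //; exists (- v) => //; rewrite subrr.
have key a : 0 < a < c -> exists (U : set P) (tau : R), [/\ nbhs pbar U, 0 < tau &
    forall x p y, `|x - xbar| < tau -> U p -> F x p y ->
      exists2 u, S p u & `|x - u| <= a^-1 * `|y| ].
  move=> ac; have /andP[a0 _] := ac.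
  have [r1 r10 est] := solution_estimate X Y C xbar r a c XA YA CC r0 ac.
  have D0 : (ball (0 : Y) r1) 0 by exact: ballxx.
  have [W [[[A B] /= [nA nB] AB] FW]] := isc _ (ball_open _ _) D0.
  have /nbhs_normP[t /= t0 tA] := nA.
  exists (U1 `&` U2 `&` B), (Num.min r1 t); split.
  - by apply: filterI => //; exact: filterI.
  - by rewrite lt_min r10.
  move=> x p y; rewrite lt_min => /andP[xr xt] [[U1p U2p] Bp] Fxy.
  have small z : F x p z -> `|z| < r1 -> exists2 u, S p u & `|x - u| <= a^-1 * `|z|.
    move=> Fz zr.
    have [u [v [Guv Cv xu]]] := est _ (cU1 p U1p) (iii p U2p) x z Fz xr zr.
    by exists u => //; exact: SE Guv Cv.
  (* For [|y| >= r1], inner semicontinuity supplies another value [z] with [|z| < r1], whose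
     estimate is stronger. *)
  have [/small|yr] := ltP `|y| r1; first exact.
  have [|z [/= Fz]] := FW (x, p).
    by apply: AB; split=> //=; apply: tA; rewrite /ball_/= distrC.
  rewrite -ball_normE /ball_/= sub0r normrN => zr.
  have [u Su xu] := small z Fz zr; exists u => //; apply: le_trans xu _.
  by rewrite ler_pM2l ?invr_gt0//; exact: ltW (lt_le_trans zr yr).
split=> [a ac|dP [dP0 [dP00 [dPs [dPt dPn]]]] a ac]; have /andP[a0 _] := ac;
    have [U [tau [nU tau0 est]]] := key a ac.
  exists U, tau; split=> //; split=> // x p xt Up.
  rewrite muleC -lee_pdivrMr ?invr_gt0//.
  apply: le_ereal_inf_tmp => _ [y Fy <-]; rewrite lee_pdivrMr ?invr_gt0// sub0r normrN.
  have [u Su xu] := est x p y xt Up Fy.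
  apply: (@le_trans _ _ (`|x - u|)%:E); first by apply: ereal_inf_lbound; exists u.
  by rewrite -EFinM lee_fin mulrC.
have [e [e0 eU]] := (dPn pbar U).1 nU.
pose t := Num.min tau e / 4.
have t0 : 0 < t by rewrite divr_gt0// lt_min tau0.
have [tt te] : 4 * t <= tau /\ 4 * t <= e.
  have : Num.min tau e = 4 * t by rewrite /t; field.
  by move=> <-; split; rewrite ge_min lexx ?orbT.
have a1 : 0 < 1 + a^-1 by rewrite ltr_wpDr// invr_ge0 ltW.
exists t, t; split=> //; split=> // x p xt pt.
rewrite muleC -lee_pdivrMr//.
apply: le_ereal_inf_tmp => _ [[[u q] v] /= Fuqv <-]; rewrite lee_pdivrMr// -EFinM.
set s := `|x - u| + dP p q + `|0 - v|; rewrite sub0r normrN in s *.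
have ai0 : 0 < a^-1 by rewrite invr_gt0.
(* For [s < 2 t], both [u] and [q] are within [3 t] of the reference point, where the first estimate
   holds. Otherwise [(pbar, xbar)], a point of the graph of [S], is already at distance below
   [2 t <= s]. *)
have [st|st] := ltP s (2 * t).
  have [s1 s2 s3] : [/\ `|x - u| <= s, dP p q <= s & 0 <= `|x - u| + dP p q].
    split; rewrite /s; move: (dP0 p q) (normr_ge0 v) (normr_ge0 (x - u)); clear; lra.
  have [||z Sz uz] := est u q v _ _ Fuqv.
  - have := ler_normD (u - x) (x - xbar); rewrite addrA subrK [`|u - x|]distrC.
    by move: s1 st xt tt t0; clear; lra.
  - apply: eU => /=; have := dPt pbar p q.
    by move: s2 st pt te t0; clear; lra.
  apply: (@le_trans _ _ (dP p q + `|x - z|)%:E).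
    by apply: ereal_inf_lbound; exists (q, z).
  rewrite lee_fin; have := ler_normD (x - u) (u - z); rewrite addrA subrK.
  have := mulr_ge0 (ltW ai0) s3.
  by move: uz (normr_ge0 v); rewrite /s; clear; lra.
apply: (@le_trans _ _ (dP p pbar + `|x - xbar|)%:E).
  apply: ereal_inf_lbound; exists (pbar, xbar) => //=.
  by apply: (SE pbar xbar 0) => //; rewrite oppr0; exact: CC.1.
rewrite lee_fin dPs; have := mulr_gt0 ai0 t0; have := ler_wpM2l (ltW ai0) st.
by move: st xt pt; clear; lra.
Qed.
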